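(* Let $\mathbb{F}$ be any field and let $L$ be a nilpotent symplectic alternating algebra over $\mathbb{F}$ of dimension $10$ with an isotropic center of dimension $3$ that has the further properties that $\dim L^3=6$, $L^3L^2=L^5$ and $L$ is of type $A$. Then $L$ has a presentation of the form $$\mathcal{P}_{10}^{(3,6)}(r):\quad (x_2y_4,y_5)=r,\ (x_1y_2,y_4)=1,\ (y_1y_2,y_5)=1,\ (y_1y_3,y_5)=1,$$ where $r\in\mathbb{F}$, $r\neq 0$. Furthermore the presentations $\mathcal{P}_{10}^{(3,6)}(r)$ and $\mathcal{P}_{10}^{(3,6)}(s)$ (with $r,s\in\mathbb{F}^*$) describe the same algebra if and only if $s/r\in(\mathbb{F}^* )^3$.
   Context: A symplectic alternating algebra (SAA) over a field $\mathbb{F}$ is a finite-dimensional vector space $L$ over $\mathbb{F}$ with a non-degenerate alternating bilinear form $(\ ,\ )$ and a bilinear product $\cdot$ satisfying $u\cdot u=0$ for all $u$ and $(u\cdot v,w)=(v\cdot w,u)$ for all $u,v,w\in L$. No associativity or Jacobi identity is assumed. The map $(u,v,w)\mapsto(uv,w)$ is then an alternating trilinear form. A standard basis (in dimension $10$) is a basis $x_1,y_1,\ldots,x_5,y_5$ with $(x_i,x_j)=(y_i,y_j)=0$ and $(x_i,y_j)=\delta_{ij}$ for all $i,j$. Presentations: $L$ has a presentation if there is a standard basis for which the listed values of triples $(uv,w)$ hold and $(uv,w)=0$ for all triples of basis elements that are not a reordering of a listed one. Two presentations describe the same algebra if the corresponding $10$-dimensional SAA's are isomorphic (by a linear bijection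 preserving product and form). $\mathbb{F}^*=\mathbb{F}\setminus\{0\}$, $(\mathbb{F}^* )^3=\{a^3:a\in\mathbb{F}^*\}$. For subspaces $U,V$, $UV$ is the span of all products $uv$. $L^1=L$, $L^{m+1}=L^mL$; $Z_0(L)=\{0\}$, $Z_{m+1}(L)=\{x: xL\leq Z_m(L)\}$, $Z(L)=Z_1(L)$. $L$ is nilpotent if $L^{m+1}=\{0\}$ for some $m\ge 0$. $Z(L)$ is isotropic if $(u,v)=0$ for all $u,v\in Z(L)$. Type: let $L$ be nilpotent of dimension $10$ with isotropic center of dimension $3$, $\dim L^3=6$ and $L^3L^2=L^5$. Then one can choose a standard basis with $L^5=\mathbb{F}x_5+\mathbb{F}x_4$, $Z(L)=L^5+\mathbb{F}x_3$, $L^4=Z_2(L)=Z(L)+\mathbb{F}x_2$, $L^3=Z_3(L)=L^4+\mathbb{F}x_1+\mathbb{F}y_1$, $L^2=L^3+\mathbb{F}y_2$, $Z_4(L)=L^2+\mathbb{F}y_3$. The linear maps $\phi,\psi:L^3/L^4\to L^5$, $\phi(u+L^4)=uy_2$, $\psi(u+L^4)=uy_3$ are well defined, $\phi$ is bijective, and the minimal polynomial of $\tau=\psi\phi^{-1}:L^5\to L^5$ has degree $2$. $L$ is of type $A$ if this minimal polynomial has two distinct roots in $\mathbb{F}$, of type $B$ if it has a double root in $\mathbb{F}$, and of type $C$ if it is irreducible in $\mathbb{F}[t]$; this does not depend on the choice of such a standard basis. *)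

(* Defs.v *)
From HB Require Import structures.
From mathcomp Require Import all_boot all_order all_algebra.

Set Implicit Arguments.
Unset Strict Implicit.
Unset Printing Implicit Defensive.

Import GRing.Theory.
Local Open Scope ring_scope.

(* Finite dimensionality is part of vectType. *)
HB.mixin Record isSAA (F : fieldType) L of Vector F L := {
  sform : {bilinear L -> L -> F | *%R & *%R};
  smul : {bilinear L -> L -> L};
  sform_alt : forall u, sform u u = 0;
  sform_nondeg : forall u, (forall v, sform u v = 0) -> u = 0;
  smul_alt : forall u, smul u u = 0;
  sform_smul : forall u v w, sform (smul u v) w = sform (smul v w) u
}.

#[short(type="saaType")]
HB.structure Definition SAA (F : fieldType) := {L of Vector F L & isSAA F L}.

Section Subspaces.
Variables (F : fieldType) (L : saaType F).
Implicit Types (U V W : {vspace L}) (u v : L).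

(* Spanned by products of basis vectors, as prodv in falgebra.v; smulvP shows
   that this is the span of all products. *)
Definition smulv U V : {vspace L} :=
  <<[seq smul u v | u <- vbasis U, v <- vbasis V]>>%VS.

Lemma smulvP U V W :
  reflect (forall u v, u \in U -> v \in V -> smul u v \in W)
          (smulv U V <= W)%VS.
Proof.
apply: (iffP idP) => [sW u v Uu Vv | sW].
  rewrite (coord_vbasis Uu) (coord_vbasis Vv).
  rewrite linear_sumr; apply: memv_suml => j _.
  rewrite linear_sumlz; apply: memv_suml => i _.
  rewrite linearZr_LR linearZl_LR !memvZ //.
  by apply: (subvP sW); apply: memv_span; apply: allpairs_f; apply: mem_nth;
    rewrite size_tuple.
apply/span_subvP => _ /allpairsP[[u v] /= [Uu Vv ->]].
by apply: sW; apply: vbasis_mem.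
Qed.

(* lower m is L^m for m >= 1 (the value at 0 is junk). *)
Definition lower (m : nat) : {vspace L} :=
  iter m.-1 (fun U => smulv U fullv) fullv.

(* Z_m(L); see memv_upperS for the defining property. *)
Fixpoint upper (m : nat) : {vspace L} :=
  if m is m'.+1 then
    (\bigcap_(v <- vbasis fullv) linfun (applyr smul v : L -> L) @^-1: upper m')%VS
  else 0%VS.

Lemma memv_upperS m u :
  reflect (forall v, smul u v \in upper m) (u \in upper m.+1).
Proof.
have -> : (u \in upper m.+1) = all (fun v => smul u v \in upper m) (vbasis {:L}).
  rewrite /= -big_all.
  elim/big_ind2: _ => [|a U b V <- <-|v _]; first by rewrite memvf.
    by rewrite memv_cap.
  by rewrite -memv_preim lfunE.
apply: (iffP allP) => [uZ v | uZ v _]; last exact: uZ.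
rewrite (coord_vbasis (memvf v)) linear_sumr; apply: memv_suml => i _.
by rewrite linearZr_LR memvZ // uZ // mem_nth // size_tuple.
Qed.

Definition center : {vspace L} := upper 1.

Definition nilpotent_saa : Prop := exists m : nat, lower m.+1 = 0%VS.

Definition isotropic U : Prop := forall u v, u \in U -> v \in U -> sform u v = 0.

End Subspaces.

Arguments lower {F} L m.
Arguments upper {F} L m.
Arguments center {F} L.
Arguments nilpotent_saa {F} L.

(* Labels of the basis vectors in dimension 10: X k, Y k (1 <= k <= 5) label
   x_k, y_k. *)
Notation label := ('I_5 + 'I_5)%type.
Definition X (k : nat) : label := inl (inord k.-1).
Definition Y (k : nat) : label := inr (inord k.-1).

Section StandardBasis.
Variables (F : fieldType) (L : saaType F).

Definition standard_basis (b : label -> L) : Prop :=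
  [/\ basis_of fullv (codom b),
      forall i j, sform (b (inl i)) (b (inl j)) = 0,
      forall i j, sform (b (inr i)) (b (inr j)) = 0
    & forall i j, sform (b (inl i)) (b (inr j)) = (i == j)%:R].

End StandardBasis.

(* An entry (i, j, k, a) lists the value (b_i b_j, b_k) = a. *)
Definition presentation (F : fieldType) := seq (label * label * label * F).

Definition has_presentation (F : fieldType) (L : saaType F)
    (P : presentation F) : Prop :=
  exists b : label -> L,
  [/\ standard_basis b,
      forall (i j k : label) a, (i, j, k, a) \in P -> sform (smul (b i) (b j)) (b k) = a
    & forall i j k : label,
        (forall (i' j' k' : label) a, (i', j', k', a) \in P ->
           ~~ perm_eq [:: i; j; k] [:: i'; j'; k']) ->
        sform (smul (b i) (b j)) (b k) = 0].

Definition saa_iso (F : fieldType) (L M : saaType F) : Prop :=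
  exists f : 'Hom(L, M),
  [/\ bijective f,
      forall u v, f (smul u v) = smul (f u) (f v)
    & forall u v, sform (f u) (f v) = sform u v].

(* By presentation_unique below, an algebra with a given presentation is
   unique up to isomorphism. *)
Definition same_algebra (F : fieldType) (P Q : presentation F) : Prop :=
  exists L M : saaType F,
  [/\ has_presentation L P, has_presentation M Q & saa_iso L M].

Section Unique.
Variable F : fieldType.

Lemma sform_skew (L : saaType F) (u v : L) : sform u v = - sform v u.
Proof.
apply/eqP; rewrite -addr_eq0; apply/eqP.
have := sform_alt (u + v); rewrite linearDr !linearDl !sform_alt add0r addr0.
by rewrite addrC.
Qed.

Lemma smul_skew (L : saaType F) (u v : L) : smul u v = - smul v u.
Proof.
apply/eqP; rewrite -addr_eq0; apply/eqP.
have := smul_alt (u + v); rewrite linearDr !linearDl !smul_alt add0r addr0.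
by rewrite addrC.
Qed.

Lemma presentation_unique (L M : saaType F) (P : presentation F) :
  has_presentation L P -> has_presentation M P -> saa_iso L M.
Proof.
case=> b [[bB bx by_ bxy] bP b0] [c [[cB cx cy cxy] cP c0]].
have tri i j k : sform (smul (b i) (b j)) (b k) = sform (smul (c i) (c j)) (c k).
  have [/hasP[[[[i' j'] k'] a] Pt /= ijk] | no] :=
    boolP (has (fun t => perm_eq [:: i; j; k] [:: t.1.1.1; t.1.1.2; t.1.2]) P).
    have e : sform (smul (b i') (b j')) (b k') =
             sform (smul (c i') (c j')) (c k') by rewrite (bP _ _ _ _ Pt) (cP _ _ _ _ Pt).
    have cyc p q r : sform (smul (b p) (b q)) (b r) = sform (smul (c p) (c q)) (c r) ->
        sform (smul (b q) (b r)) (b p) = sform (smul (c q) (c r)) (c p).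
      by rewrite sform_smul => ->; rewrite sform_smul.
    have swp p q r : sform (smul (b p) (b q)) (b r) = sform (smul (c p) (c q)) (c r) ->
        sform (smul (b q) (b p)) (b r) = sform (smul (c q) (c p)) (c r).
      move=> h; rewrite smul_skew (smul_skew (c q)) !linearNl.
      by congr (- _).
    have pair p q r s : perm_eq [:: p; q] [:: r; s] -> (p = r /\ q = s) \/ (p = s /\ q = r).
      move=> h; have := perm_mem h p; rewrite !inE eqxx /=.
      case: eqP h => [-> | _] /=.
        by rewrite perm_cons => /perm_mem /(_ q); rewrite !inE eqxx => /esym/eqP->; left.
      move=> h /esym/eqP eps; move: h; rewrite {p}eps (perm_sym _ [:: r; s]).
      rewrite (perm_catC [:: r] [:: s]) perm_cons => /perm_mem /(_ r).
      by rewrite !inE eqxx => /esym/eqP->; right.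
    have := perm_mem ijk i; rewrite !inE eqxx /= => /esym/or3P[] /eqP ei; subst i.
    - move: ijk; rewrite perm_cons => /pair[] [-> ->] //.
      by apply: (cyc); apply: (swp).
    - have : perm_eq [:: j'; j; k] [:: j'; i'; k'].
        by apply: (perm_trans ijk); apply: (permEl (perm_catCA [:: i'] [:: j'] [:: k'])).
      rewrite perm_cons => /pair[] [-> ->]; first exact: swp.
      exact: cyc.
    have : perm_eq [:: k'; j; k] [:: k'; i'; j'].
      by apply: (perm_trans ijk); apply: (permEl (perm_catC [:: i'; j'] [:: k'])).
    rewrite perm_cons => /pair[] [-> ->]; first by apply: (cyc); apply: (cyc).
    by apply: (swp); apply: (cyc).
  have np i' j' k' a : (i', j', k', a) \in P -> ~~ perm_eq [:: i; j; k] [:: i'; j'; k'].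
    by move=> Pt; apply: contra no => h; apply/hasP; exists (i', j', k', a).
  by rewrite b0 ?c0.
have frm i j : sform (b i) (b j) = sform (c i) (c j).
  case: i j => i [] j; rewrite ?bx ?cx ?by_ ?cy ?bxy ?cxy //.
  by rewrite sform_skew bxy sform_skew cxy.
have sz : size (codom c) = size (codom b) by rewrite !size_codom.
have [f fb] := linear_of_free (codom b) (codom c).
have {}fb := fb (basis_free bB) sz.
have fbi i : f (b i) = c i.
  move: fb; rewrite codomE -map_comp codomE => /eq_in_map/(_ i) /=; apply.
  by rewrite mem_enum.
have spn (K : saaType F) (d : label -> K) (dB : basis_of fullv (codom d)) (Q : K -> Prop) :
    (forall i, Q (d i)) -> (forall a u v, Q u -> Q v -> Q (a *: u + v)) -> Q 0 ->
    forall u, Q u.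
  move=> Qd Qlin Q0 u; have : u \in <<codom d>>%VS by rewrite (span_basis dB) memvf.
  move=> ud; rewrite (coord_span (X := in_tuple (codom d)) ud).
  elim/big_rec: _ => // i v _ Qv; apply: Qlin => //.
  have /codomP[j ->] : (in_tuple (codom d))`_i \in codom d by rewrite mem_nth.
  exact: Qd.
have fF u v : sform (f u) (f v) = sform u v.
  elim/(spn _ _ bB): u => [i|a u u' h h'|]; last by rewrite linear0 !linear0l.
    elim/(spn _ _ bB): v => [j|a v v' h h'|]; last by rewrite linear0 !linear0r.
      by rewrite !fbi frm.
    by rewrite linearP !linearPr h h'.
  by rewrite linearP !linearPl h h'.
have finj : injective f.
  move=> u v /eqP; rewrite -subr_eq0 -linearB => /eqP h.
  apply/eqP; rewrite -subr_eq0; apply/eqP; apply: sform_nondeg => w.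
  by rewrite -fF h linear0l.
have fsurj w : exists u, f u = w.
  elim/(spn _ _ cB): w => [i|a w w' [u <-] [u' <-]|].
  - by exists (b i).
  - by exists (a *: u + u'); rewrite linearP.
  - by exists 0; rewrite linear0.
have fT u v w : sform (smul (f u) (f v)) (f w) = sform (smul u v) w.
  elim/(spn _ _ bB): u => [i|a u u' h h'|]; last by rewrite linear0 !linear0l.
    elim/(spn _ _ bB): v => [j|a v v' h h'|];
        last by rewrite linear0 !linear0r !linear0l.
      elim/(spn _ _ bB): w => [k|a w w' h h'|]; last by rewrite linear0 !linear0r.
        by rewrite !fbi tri.
      by rewrite linearP !linearPr h h'.
    by rewrite linearP !linearPr !linearPl h h'.
  by rewrite linearP !linearPl h h'.
exists (linfun f); split.
- have ki : lker (linfun f) == 0%VS.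
    by apply/lker0P => u v; rewrite !lfunE; apply: finj.
  exists (linfun f)^-1%VF; first exact: lker0_lfunK.
  move=> w; have [u <-] := fsurj w.
  by rewrite -[f u](lfunE f) lker0_lfunK.
- move=> u v; rewrite !lfunE /=; apply/eqP; rewrite -subr_eq0; apply/eqP.
  apply: sform_nondeg => w; have [z <-] := fsurj w.
  by rewrite linearBl fT fF subrr.
- by move=> u v; rewrite !lfunE.
Qed.

End Unique.

Section LinearAlgebra.
Variables (F : fieldType) (V : vectType F).

(* The quotient U / W (for W <= U), carried by the complement U :\: W of W in
   U; for u in U, quotv_proj U W u is the class u + W. *)
Definition quotv (U W : {vspace V}) : vectType F := subvs_of (U :\: W)%VS.

Definition quotv_proj (U W : {vspace V}) : 'Hom(V, quotv U W) :=
  (linfun (vsproj (U :\: W)%VS) \o daddv_pi (U :\: W) W)%VF.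

Lemma quotv_proj_surj U W (q : quotv U W) :
  exists2 u, u \in U & quotv_proj U W u = q.
Proof.
exists (vsval q); first exact: (subvP (diffvSl U W) _ (subvsP q)).
by rewrite comp_lfunE lfunE /= daddv_pi_id ?capv_diff ?subvsP // vsvalK.
Qed.

Lemma quotv_proj_eq0 (U W : {vspace V}) u : (W <= U)%VS -> u \in U ->
  (quotv_proj U W u == 0) = (u \in W).
Proof.
move=> sWU Uu; have sumU : u \in (U + W)%VS by rewrite (subvP (addvSl U W)).
have e := addv_pi1_pi2 sumU; rewrite comp_lfunE lfunE /=.
rewrite -(inj_eq val_inj) linear0 /= vsprojK ?memv_pi //.
apply/eqP/idP => [h | Wu].
  by rewrite -e /addv_pi1 h add0r memv_pi2.
by move: e; rewrite addv_pi2_id // -[RHS]add0r => /addIr.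
Qed.

Definition lfun_horner (f : 'End(V)) (p : {poly F}) : 'End(V) :=
  \sum_(i < size p) p`_i *: iter i (comp_lfun f) \1%VF.

Definition is_minpoly (f : 'End(V)) (p : {poly F}) : Prop :=
  [/\ p \is monic, lfun_horner f p = 0
    & forall q, lfun_horner f q = 0 -> p %| q].

End LinearAlgebra.

Section TypeA.
Variables (F : fieldType) (L : saaType F).

Definition adapted_basis (b : label -> L) : Prop :=
  [/\ standard_basis b,
      lower L 5 = (<[b (X 5)]> + <[b (X 4)]>)%VS,
      center L = (lower L 5 + <[b (X 3)]>)%VS,
      lower L 4 = upper L 2 /\ upper L 2 = (center L + <[b (X 2)]>)%VS
    & [/\ lower L 3 = upper L 3,
          upper L 3 = (lower L 4 + <[b (X 1)]> + <[b (Y 1)]>)%VS,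
          lower L 2 = (lower L 3 + <[b (Y 2)]>)%VS
        & upper L 4 = (lower L 2 + <[b (Y 3)]>)%VS]].

(* f : L^3/L^4 -> L^5 is the map u + L^4 |-> u y. *)
Definition is_quot_rmul (y : L)
    (f : 'Hom(quotv (lower L 3) (lower L 4), subvs_of (lower L 5))) : Prop :=
  forall u, u \in lower L 3 ->
    vsval (f (quotv_proj (lower L 3) (lower L 4) u)) = smul u y.

(* Meant for nilpotent L of dimension 10 with isotropic center of dimension 3,
   dim L^3 = 6 and L^3 L^2 = L^5: adapted bases then exist, phi and psi exist
   uniquely, phi is bijective (so phi^-1 is its inverse), the minimal polynomial
   has degree 2, and the type does not depend on the basis. *)
Definition type_A : Prop :=
  exists b phi psi,
  [/\ adapted_basis b, is_quot_rmul (b (Y 2)) phi, is_quot_rmul (b (Y 3)) psi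
    & exists p, is_minpoly (psi \o phi^-1)%VF p /\
        exists a c, [/\ a != c, root p a & root p c]].

End TypeA.

Arguments type_A {F} L.

Definition P36 (F : fieldType) (r : F) : presentation F :=
  [:: (X 2, Y 4, Y 5, r); (X 1, Y 2, Y 4, 1);
      (Y 1, Y 2, Y 5, 1); (Y 1, Y 3, Y 5, 1)].

(* Main.v *)
Require Import Defs.
From HB Require Import structures.
From mathcomp Require Import all_boot all_order all_algebra.
From mathcomp Require Import ring zify.

(** Everything is read off the alternating trilinear form (uv, w), which
determines the product because the form is non-degenerate.

Existence.  Let x_i, y_i be an adapted basis.  Since L^{m+1} is orthogonal to
Z_m (lower_upper_orth) and L^3 = Z_3, the triples with an entry in the center,
with entries in Z_2 and Z_4, or with two entries in L^3 vanish; since L^3 L^2 =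
L^5, so do those with entries in L^3, L^2 and Z_4.  Listing the basis in the
order x5, x4, x3, x2, x1, y1, ..., y5, which refines this flag of subspaces,
only fifteen triples survive.  The maps u |-> u y2 and u |-> u y3 carry
L^3/L^4 into L^5; type A provides u, v in <x1, y1>, with u y2 and v y2
independent, such that u y3 = al (u y2) and v y3 = ga (v y2) with al <> ga
(type_A_eigen).  Taking u and a multiple of v as new x1, y1, their products
with y2 as new x4, x5, and (y3 - al y2) / (ga - al) as new y3 gives
x1 y2 = x4, x1 y3 = 0, y1 y2 = y1 y3 = x5 (diagonal_exists).  The value
r = (x2 y4, y5) is not 0, since otherwise x2 would be central, hence orthogonal
to y2.  So adding multiples of x2 to x1, y1, y2, y3 clears the triples with
y4, y5, and adding elements of <x1, y1> to y3 clears (y2 y3, y4) and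
(y2 y3, y5) (diagonal_normalize).

Invariance.  Suppose that b and c are bases of the same algebra with parameters
r and s.  Being described by products, c_{x2} lies in Z_2, c_{x1} and c_{y1} in
L^3, and c_{y2} in L^2.  Hence c_{y2} = lam y2 modulo L^3 and
c_{x2} = lam^-1 x2 modulo the center.  Let D be the determinant of the (y4, y5)-coordinates of
c_{y4}, c_{y5}, and E that of the (x1, y1)-coordinates of c_{x1}, c_{y1}.  Then
E = (c_{x1}, c_{y1}) = 1, while the four values (c_{x1} c_{y2}, c_{y4}), ...
form the identity matrix, so lam^2 E D = 1.  Finally
s = (c_{x2} c_{y4}, c_{y5}) = lam^-1 r D = r lam^-3 (P36_invariant).

Conversely a suitable diagonal change of basis multiplies r by any given cube
(is_P36_rescale), and an algebra with parameter r exists: a separated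
presentation defines a trilinear form on F^10, hence a product
(model_presented). *)

Set Implicit Arguments.
Unset Strict Implicit.
Unset Printing Implicit Defensive.

Import GRing.Theory.
Local Open Scope ring_scope.

(** * Standard bases *)

Section StandardBases.
Variables (F : fieldType) (L : saaType F).
Implicit Types (b : label -> L) (u v w : L).

(** The coordinate functions dual to a standard basis, through the form:
u = sum (u, y_i) x_i + (x_i, u) y_i. *)
Definition scoord b (l : label) u : F :=
  match l with
  | inl i => sform u (b (inr i))
  | inr i => sform (b (inl i)) u
  end.

Lemma scoordP b l a u v : scoord b l (a *: u + v) = a * scoord b l u + scoord b l v.
Proof. by case: l => i /=; rewrite ?linearPl ?linearPr. Qed.

Lemma scoord_basis b l m : standard_basis b -> scoord b l (b m) = (l == m)%:R.
Proof.
case=> _ xx yy xy.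
case: l => i; case: m => j /=; rewrite ?xx ?yy ?xy //.
by rewrite -[RHS]/((i == j)%:R) eq_sym.
Qed.

Lemma standard_ind b (sb : standard_basis b) (Q : L -> Prop) :
  (forall l, Q (b l)) -> (forall a u v, Q u -> Q v -> Q (a *: u + v)) -> Q 0 ->
  forall u, Q u.
Proof.
case: sb => bB _ _ _ Qb Qlin Q0 u.
have ud : u \in <<codom b>>%VS by rewrite (span_basis bB) memvf.
rewrite (coord_span (X := in_tuple (codom b)) ud).
elim/big_rec: _ => // i v _ Qv; apply: Qlin => //.
have /codomP[l ->] : (in_tuple (codom b))`_i \in codom b by rewrite mem_nth.
exact: Qb.
Qed.

(** Independence comes from the Gram relations, by pairing a linear relation with
the dual basis vectors; the dimension does the rest. *)
Lemma standard_gram b : \dim {:L} = 10%N ->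
  (forall i j, sform (b (inl i)) (b (inl j)) = 0) ->
  (forall i j, sform (b (inr i)) (b (inr j)) = 0) ->
  (forall i j, sform (b (inl i)) (b (inr j)) = (i == j)%:R) ->
  standard_basis b.
Proof.
move=> dimL xx yy xy; split=> //.
rewrite basisEfree subvf dimL size_codom card_sum card_ord leqnn !andbT.
have -> : codom b = codom_tuple b by [].
apply/freeP => k k0 i.
have lin m : scoord b m (\sum_(j < #|{: label}|) k j *: (codom_tuple b)`_j) =
             \sum_(j < #|{: label}|) k j * (m == enum_val j)%:R.
  elim/big_rec2: _ => [|j s u _ <-]; first by case: m => m /=; rewrite ?linear0l ?linear0r.
  rewrite scoordP; congr (_ * _ + _).
  have -> : (codom_tuple b)`_j = b (enum_val j).
    rewrite (nth_map (enum_val j)) -?cardE //; congr (b _).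
    by rewrite [RHS](enum_val_nth (enum_val j)).
  case: m (enum_val j) => p [] q /=; rewrite ?xx ?yy ?xy //.
  by rewrite -[RHS]/((p == q)%:R) eq_sym.
have := lin (enum_val i); rewrite k0 (bigD1 i) //= eqxx mulr1 big1 => [|j ji].
  by rewrite addr0 => <-; case: (enum_val i) => m /=; rewrite ?linear0l ?linear0r.
by rewrite (inj_eq enum_val_inj) eq_sym (negPf ji) mulr0.
Qed.

Lemma standard_dim b : standard_basis b -> \dim {:L} = 10%N.
Proof.
by case=> bB _ _ _; rewrite (size_basis (X := codom_tuple b) bB) card_sum !card_ord.
Qed.
End StandardBases.
Arguments standard_ind {F L b} sb Q _ _ _ _.

(** * Wedges of coordinate functions *)

Section Wedge.
Variables (F : fieldType) (T : Type).
Implicit Types (f g h : T -> F) (u v w : T).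

(** The 3 x 3 determinant of f, g, h at u, v, w, expanded along u. *)
Definition wedge f g h u v w : F :=
  f u * (g v * h w - h v * g w) - g u * (f v * h w - h v * f w)
  + h u * (f v * g w - g v * f w).

(** Without this condition the values prescribed by P could contradict each other
or the alternating law. *)
Definition separated (P : presentation F) : bool :=
  all (fun e => uniq [:: e.1.1.1; e.1.1.2; e.1.2]) P &&
  pairwise (fun e e' => ~~ perm_eq [:: e'.1.1.1; e'.1.1.2; e'.1.2]
                                   [:: e.1.1.1; e.1.1.2; e.1.2]) P.

Definition pform (P : presentation F) (c : label -> T -> F) u v w : F :=
  \sum_(e <- P) e.2 * wedge (c e.1.1.1) (c e.1.1.2) (c e.1.2) u v w.

Lemma pform_alt P c u w : pform P c u u w = 0.
Proof. by rewrite /pform big1 // => e _; rewrite /wedge; ring. Qed.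

Lemma pform_cycle P c u v w : pform P c u v w = pform P c v w u.
Proof. by apply: eq_bigr => e _; congr (_ * _); rewrite /wedge; ring. Qed.

Lemma pform_swap P c u v w : pform P c v u w = - pform P c u v w.
Proof. by rewrite -sumrN; apply: eq_bigr => e _; rewrite /wedge; ring. Qed.

Lemma pform_linear P c a x u u' v w :
    (forall l, c l x = a * c l u + c l u') ->
  pform P c x v w = a * pform P c u v w + pform P c u' v w.
Proof.
move=> cx; rewrite mulr_sumr -big_split; apply: eq_bigr => e _ /=.
by rewrite /wedge !cx; ring.
Qed.

Variables (b : label -> T) (c : label -> T -> F).
Hypothesis cb : forall l m, c l (b m) = (l == m)%:R.

Lemma wedge_dual i j k : uniq [:: i; j; k] ->
  wedge (c i) (c j) (c k) (b i) (b j) (b k) = 1.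
Proof.
rewrite /= !inE negb_or andbT => /andP[/andP[ij ik] jk].
rewrite /wedge !cb !eqxx [j == i]eq_sym [k == i]eq_sym [k == j]eq_sym.
by rewrite (negPf ij) (negPf ik) (negPf jk) /=; ring.
Qed.

(** Each of the six terms of the determinant is nonzero only when (i, j, k) is one
particular rearrangement of (p, q, s). *)
Lemma wedge_nonperm i j k p q s : ~~ perm_eq [:: p; q; s] [:: i; j; k] ->
  wedge (c i) (c j) (c k) (b p) (b q) (b s) = 0.
Proof.
move=> np.
have z x y z : perm_eq [:: p; q; s] [:: x; y; z] ->
    c i (b x) * (c j (b y) * c k (b z)) = 0.
  move=> pxyz; rewrite !cb; have [ix|_] := eqVneq i x; last by rewrite mul0r.
  have [jy|_] := eqVneq j y; last by rewrite mul0r mulr0.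
  have [kz|_] := eqVneq k z; last by rewrite !mulr0.
  by case/negP: np; rewrite ix jy kz.
have e1 : perm_eq [:: p; q; s] [:: p; s; q].
  by rewrite perm_cons (permEl (perm_catC [:: q] [:: s])).
have e2 : perm_eq [:: p; q; s] [:: q; p; s].
  exact: (permEl (perm_catCA [:: p] [:: q] [:: s])).
have e3 : perm_eq [:: p; q; s] [:: q; s; p].
  exact: (permEl (perm_catC [:: p] [:: q; s])).
have e4 : perm_eq [:: p; q; s] [:: s; p; q].
  exact: (permEl (perm_catC [:: p; q] [:: s])).
have e5 : perm_eq [:: p; q; s] [:: s; q; p].
  by rewrite (perm_trans e3) // (permEl (perm_catCA [:: q] [:: s] [:: p])).
transitivity (
  c i (b p) * (c j (b q) * c k (b s)) - c i (b p) * (c j (b s) * c k (b q))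
  - c i (b q) * (c j (b p) * c k (b s)) + c i (b s) * (c j (b p) * c k (b q))
  + c i (b q) * (c j (b s) * c k (b p)) - c i (b s) * (c j (b q) * c k (b p))).
  by rewrite /wedge; ring.
by rewrite !z //; ring.
Qed.

Lemma pform_nonperm P i j k :
    (forall e, e \in P ->
       ~~ perm_eq [:: i; j; k] [:: e.1.1.1; e.1.1.2; e.1.2]) ->
  pform P c (b i) (b j) (b k) = 0.
Proof.
move=> np; rewrite /pform big_seq big1 // => e Pe.
by rewrite wedge_nonperm ?mulr0 ?np.
Qed.

Lemma pform_listed P i j k a : separated P -> (i, j, k, a) \in P ->
  pform P c (b i) (b j) (b k) = a.
Proof.
case/andP; elim: P => //= e P IH /andP[ue uP] /andP[ne nP].
rewrite inE /pform big_cons => /predU1P[ee | Pe].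
  rewrite -/(pform _ _ _ _ _) -{}ee /= in ue ne *.
  rewrite (wedge_dual ue) mulr1 pform_nonperm ?addr0 // => e' Pe'.
  by rewrite perm_sym; apply: (allP ne).
rewrite -/(pform _ _ _ _ _) IH // wedge_nonperm ?mulr0 ?add0r //.
exact: (allP ne _ Pe).
Qed.
End Wedge.

(** * Presentations as trilinear forms *)

(** The 3-cycle and the transposition generate all rearrangements of a triple. *)
Lemma perm3_ind (T : eqType) (D : T -> T -> T -> Prop) :
  (forall i j k, D i j k -> D j k i) -> (forall i j k, D i j k -> D j i k) ->
  forall i j k p q s, perm_eq [:: i; j; k] [:: p; q; s] -> D p q s -> D i j k.
Proof.
move=> cyc swp i j k p q s e D0.
have two x y z t : perm_eq [:: x; y] [:: z; t] -> (x = z /\ y = t) \/ (x = t /\ y = z).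
  move=> h; have := perm_mem h x; rewrite !inE eqxx /= => /esym/orP[]/eqP xe; subst x.
    by move: h; rewrite perm_cons => /perm_mem /(_ y); rewrite !inE eqxx => /esym/eqP->; left.
  move: h; rewrite perm_sym -[[:: z; t]]/([:: z] ++ [:: t]) perm_catC perm_cons.
  by move=> /perm_mem /(_ z); rewrite !inE eqxx => /esym/eqP->; right.
have := perm_mem e i; rewrite !inE eqxx /= => /esym/or3P[]/eqP ie; subst i.
- move: e; rewrite perm_cons => /two[][-> ->] //.
  exact/swp/cyc/cyc.
- move: e; rewrite perm_sym -[[:: p; q; s]]/([:: p] ++ [:: q] ++ [:: s]) perm_catCA.
  rewrite perm_cons perm_sym.
  by case/two=> -[-> ->]; [apply: swp | apply: cyc].
move: e; rewrite perm_sym -[[:: p; q; s]]/([:: p; q] ++ [:: s]) perm_catC perm_cons perm_sym.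
by case/two=> -[-> ->]; [apply/cyc/cyc | apply/swp/cyc].
Qed.

Section Triples.
Variables (F : fieldType) (L : saaType F).
Implicit Types (u v w : L).

Lemma triple_swap u v w : sform (smul v u) w = - sform (smul u v) w.
Proof. by rewrite smul_skew linearNl. Qed.

Variables (P : presentation F) (b : label -> L).
Hypotheses (sP : separated P) (sb : standard_basis b).
Let cb l m := scoord_basis l m sb.

(** Both sides are alternating trilinear, so they need only agree on one ordering of
each triple of basis vectors. *)
Lemma presented_pform :
    (forall i j k a, (i, j, k, a) \in P -> sform (smul (b i) (b j)) (b k) = a) ->
    (forall i j k : label,
        (forall (i' j' k' : label) a, (i', j', k', a) \in P ->
           ~~ perm_eq [:: i; j; k] [:: i'; j'; k']) ->
        sform (smul (b i) (b j)) (b k) = 0) ->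
  forall u v w, sform (smul u v) w = pform P (scoord b) u v w.
Proof.
move=> bP b0.
have pl a u u' v w := pform_linear P v w (fun l => scoordP b l a u u').
have p0 v w : pform P (scoord b) 0 v w = 0.
  by apply: big1 => e _; rewrite /wedge; case: e => [[[[]i []j] []k] a] /=;
     rewrite ?linear0l ?linear0r; ring.
suff bas i j k : sform (smul (b i) (b j)) (b k) = pform P (scoord b) (b i) (b j) (b k).
  move=> u v w; elim/(standard_ind sb): u => [i|a u u' h h'|]; last by rewrite !linear0l p0.
    rewrite sform_smul pform_cycle.
    elim/(standard_ind sb): v => [j|a v v' h h'|]; last by rewrite !linear0l p0.
      rewrite sform_smul pform_cycle.
      elim/(standard_ind sb): w => [k|a w w' h h'|]; last by rewrite !linear0l p0.
        by rewrite sform_smul pform_cycle.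
      by rewrite !linearPl pl h h'.
    by rewrite !linearPl pl h h'.
  by rewrite !linearPl pl h h'.
have [/hasP[[[[i' j'] k'] a] Pt /= ijk] | no] :=
    boolP (has (fun e => perm_eq [:: i; j; k] [:: e.1.1.1; e.1.1.2; e.1.2]) P).
  pose D x y z := sform (smul (b x) (b y)) (b z) = pform P (scoord b) (b x) (b y) (b z).
  apply: (@perm3_ind _ D _ _ _ _ _ _ _ _ ijk) => [x y z e|x y z e|]; rewrite /D.
  - by rewrite -sform_smul -pform_cycle.
  - by rewrite triple_swap pform_swap e.
  - by rewrite (bP _ _ _ _ Pt) (pform_listed cb sP Pt).
have np e : e \in P -> ~~ perm_eq [:: i; j; k] [:: e.1.1.1; e.1.1.2; e.1.2].
  by move=> Pe; apply: contra no => h; apply/hasP; exists e.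
by rewrite (pform_nonperm cb np) b0 // => i' j' k' a /np.
Qed.

Lemma pform_presented :
    (forall u v w, sform (smul u v) w = pform P (scoord b) u v w) ->
  has_presentation L P.
Proof.
move=> e; exists b; split=> // [i j k a Pa | i j k np]; rewrite e.
  exact: pform_listed.
by apply: (pform_nonperm cb) => -[[[i' j'] k'] a] /np.
Qed.
End Triples.

Section Model.
Variables (F : fieldType) (P : presentation F).

Let V := {ffun label -> F^o}.
Implicit Types (u v w : V).

(** The symplectic space F^10 in coordinates: x_i, y_i are the vectors e, and the
product is the vector that represents the functional T u v under the form. *)
Let e (m : label) : V := [ffun l => (m == l)%:R].
Let c (l : label) (u : V) : F := u l.

Let form u v : F := \sum_i (u (inl i) * v (inr i) - u (inr i) * v (inl i)).

Let T := pform P c.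

Let prod u v : V :=
  [ffun l => match l with inl i => T u v (e (inr i)) | inr i => - T u v (e (inl i)) end].

Let cP a l u v : c l (a *: u + v) = a * c l u + c l v.
Proof. by rewrite /c !ffunE. Qed.

Let formE u v w : form (prod u v) w = T u v w.
Proof.
transitivity (\sum_m c m w * T u v (e m)).
  rewrite big_sumType /= -big_split; apply: eq_bigr => i _ /=.
  by rewrite !ffunE /c mulNr opprK addrC; congr (_ + _); apply: mulrC.
have dl l : \sum_m c m w * c l (e m) = c l w.
  rewrite (bigD1 l) //= /c ffunE eqxx mulr1 big1 ?addr0 // => m ml.
  by rewrite ffunE (negPf ml) mulr0.
transitivity (\sum_m \sum_(p <- P)
    c m w * (p.2 * wedge (c p.1.1.1) (c p.1.1.2) (c p.1.2) u v (e m))).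
  by apply: eq_bigr => m _; rewrite -mulr_sumr.
rewrite exchange_big; apply: eq_bigr => p _ /=.
set i := p.1.1.1; set j := p.1.1.2; set k := p.1.2.
pose A := c i u * c j v - c j u * c i v.
pose B := c k u * c i v - c i u * c k v.
pose C := c j u * c k v - c k u * c j v.
have W x : wedge (c i) (c j) (c k) u v x = A * c k x + B * c j x + C * c i x.
  by rewrite /wedge /A /B /C; ring.
rewrite W -(dl i) -(dl j) -(dl k) !mulr_sumr -!big_split mulr_sumr /=.
by apply: eq_bigr => m _; rewrite W; ring.
Qed.

Let form_alt u : form u u = 0.
Proof. by rewrite /form big1 // => i _; ring. Qed.

Let formDl a u u' v : form (a *: u + u') v = a * form u v + form u' v.
Proof.
rewrite /form mulr_sumr -big_split; apply: eq_bigr => i _ /=.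
by rewrite -!/(c _ _) !cP; ring.
Qed.

Let form_skew u v : form u v = - form v u.
Proof. by rewrite /form -sumrN; apply: eq_bigr => i _; ring. Qed.

Let form_bil : bilinear_for *%R *%R form.
Proof.
split=> u a v w; first exact: formDl.
by rewrite !(form_skew u) formDl /= opprD mulrN.
Qed.

Let prodDl a u u' v : prod (a *: u + u') v = a *: prod u v + prod u' v.
Proof.
have TD w : T (a *: u + u') v w = a * T u v w + T u' v w.
  by apply: pform_linear => l; apply: cP.
apply/ffunP=> l; rewrite -[RHS]/(c l (a *: prod u v + prod u' v)) cP /c !ffunE.
by case: l => i; rewrite TD // mulrN opprD.
Qed.

Let prod_skew u v : prod u v = - prod v u.
Proof.
by apply/ffunP=> -[] i; rewrite !ffunE /T pform_swap.
Qed.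

Let prod_bil : bilinear_for *:%R *:%R prod.
Proof.
split=> u a v w; first exact: prodDl.
by rewrite !(prod_skew u) prodDl opprD /= scalerN.
Qed.

HB.instance Definition _ := bilinear_isBilinear.Build F V V F _ _ form form_bil.
HB.instance Definition _ := bilinear_isBilinear.Build F V V V _ _ prod prod_bil.

Let form_inr u i : form u (e (inr i)) = c (inl i) u.
Proof.
rewrite /form (bigD1 i) //= !ffunE /= eqxx mulr1 mulr0 subr0 big1 ?addr0 // => j ji.
by rewrite !ffunE -[inr i == inr j]/(i == j) eq_sym (negPf ji) !mulr0 subr0.
Qed.

Let form_inl u i : form (e (inl i)) u = c (inr i) u.
Proof.
rewrite /form (bigD1 i) //= !ffunE /= eqxx mul1r mul0r subr0 big1 ?addr0 // => j ji.
by rewrite !ffunE -[inl i == inl j]/(i == j) eq_sym (negPf ji) !mul0r subr0.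
Qed.

Let form_nondeg u : (forall v, form u v = 0) -> u = 0.
Proof.
move=> u0; apply/ffunP=> -[] i; rewrite ffunE.
  by rewrite -[LHS]/(c _ u) -form_inr u0.
by rewrite -[LHS]/(c _ u) -form_inl form_skew u0 oppr0.
Qed.

Let prod_alt u : prod u u = 0.
Proof. by apply/ffunP=> -[] i; rewrite !ffunE /T pform_alt ?oppr0. Qed.

Let form_prod u v w : form (prod u v) w = form (prod v w) u.
Proof. by rewrite !formE /T pform_cycle. Qed.

Definition model : saaType F :=
  HB.pack {ffun label -> F^o} (isSAA.Build F V form_alt form_nondeg prod_alt form_prod).

Let b (l : label) : model := e l.

Let sb : standard_basis b.
Proof.
apply: standard_gram => [|i j|i j|i j].
- by rewrite dimvf -[LHS]/(#|{: label}| * 1)%N card_sum !card_ord.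
- rewrite -[LHS]/(form (e _) (e _)).
  by rewrite form_inl /c ffunE.
- rewrite -[LHS]/(form (e _) (e _)).
  by rewrite form_inr /c ffunE.
rewrite -[LHS]/(form (e _) (e _)).
by rewrite form_inr /c ffunE.
Qed.

Let scE l u : scoord b l u = c l u.
Proof. by case: l => i; [apply: form_inr | apply: form_inl]. Qed.

Lemma model_presented : separated P -> has_presentation model P.
Proof.
move=> sP; apply: (pform_presented sP sb) => u v w; rewrite [LHS]formE.
by apply: eq_bigr => p _; rewrite /wedge !scE.
Qed.
End Model.

(** * The parameter up to cubes *)

(** Labels built by inord are opaque to computation; this turns them into literal
ordinals, whose equality tests reduce. *)
Lemma inord5E n (h : (n < 5)%N) : inord n = Ordinal h :> 'I_5.
Proof. by apply: val_inj; rewrite /= inordK. Qed.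

Lemma P36_separated (F : fieldType) (r : F) : separated (P36 r).
Proof. by rewrite /separated /P36 /X /Y !inord5E. Qed.

Section P36Uniqueness.
Variables (F : fieldType) (L : saaType F).
Implicit Types (b c : label -> L) (u v w : L).

Lemma standard_XX b k l : standard_basis b -> sform (b (X k)) (b (X l)) = 0.
Proof. by case=> _ xx _ _; apply: xx. Qed.

Lemma standard_YY b k l : standard_basis b -> sform (b (Y k)) (b (Y l)) = 0.
Proof. by case=> _ _ yy _; apply: yy. Qed.

Lemma standard_XY b k l : standard_basis b -> (0 < k <= 5)%N -> (0 < l <= 5)%N ->
  sform (b (X k)) (b (Y l)) = (k == l)%:R.
Proof.
case=> _ _ _ xy kP lP; rewrite xy -(inj_eq val_inj) /= !inordK; [|lia|lia].
by congr (_%:R); lia.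
Qed.

Lemma standard_YX b k l : standard_basis b -> (0 < k <= 5)%N -> (0 < l <= 5)%N ->
  sform (b (Y k)) (b (X l)) = - (l == k)%:R.
Proof. by move=> sb kP lP; rewrite sform_skew standard_XY. Qed.

Lemma standard_ext b u v : standard_basis b ->
  (forall k, (0 < k <= 5)%N -> sform u (b (X k)) = sform v (b (X k))) ->
  (forall k, (0 < k <= 5)%N -> sform u (b (Y k)) = sform v (b (Y k))) -> u = v.
Proof.
move=> sb uX uY; apply/eqP; rewrite -subr_eq0; apply/eqP; apply: sform_nondeg => w.
elim/(standard_ind sb): w => [[]i|a w w' h h'|]; last by rewrite linear0r.
- by have := uX i.+1 (ltn_ord i); rewrite /X inord_val linearBl => ->; rewrite subrr.
- by have := uY i.+1 (ltn_ord i); rewrite /Y inord_val linearBl => ->; rewrite subrr.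
by rewrite linearPr h h' mulr0 addr0.
Qed.

(** The presentation in a form that can be evaluated at arbitrary vectors. *)
Definition is_P36 (b : label -> L) (r : F) : Prop :=
  standard_basis b /\ forall u v w, sform (smul u v) w =
     r * wedge (scoord b (X 2)) (scoord b (Y 4)) (scoord b (Y 5)) u v w
     + wedge (scoord b (X 1)) (scoord b (Y 2)) (scoord b (Y 4)) u v w
     + wedge (scoord b (Y 1)) (scoord b (Y 2)) (scoord b (Y 5)) u v w
     + wedge (scoord b (Y 1)) (scoord b (Y 3)) (scoord b (Y 5)) u v w.

Lemma has_presentation_P36 r : has_presentation L (P36 r) <-> exists b, is_P36 b r.
Proof.
have E b u v w : pform (P36 r) (scoord b) u v w =
     r * wedge (scoord b (X 2)) (scoord b (Y 4)) (scoord b (Y 5)) u v w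
     + wedge (scoord b (X 1)) (scoord b (Y 2)) (scoord b (Y 4)) u v w
     + wedge (scoord b (Y 1)) (scoord b (Y 2)) (scoord b (Y 5)) u v w
     + wedge (scoord b (Y 1)) (scoord b (Y 3)) (scoord b (Y 5)) u v w.
  by rewrite /pform /P36 !big_cons big_nil /= !mul1r addr0 !addrA.
split=> [[b [sb bP b0]] | [b [sb bT]]].
  exists b; split=> // u v w.
  by rewrite (presented_pform (P36_separated r) sb bP b0) E.
by apply: (pform_presented (P36_separated r) sb) => u v w; rewrite E.
Qed.

Lemma center_orth u v w : (forall z, smul u z = 0) -> sform (smul v w) u = 0.
Proof. by move=> u0; rewrite 2!sform_smul u0 linear0l. Qed.

(** This is the orthogonality of L^3 and Z_2, on generators. *)
Lemma second_center_orth u v w z : (forall p q, smul (smul u p) q = 0) ->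
  sform (smul (smul v w) z) u = 0.
Proof.
by move=> u0; rewrite sform_smul smul_skew linearNl sform_skew opprK center_orth.
Qed.

Lemma sform_coord b u v : standard_basis b ->
  sform u v = \sum_i (scoord b (inl i) u * scoord b (inr i) v
                     - scoord b (inr i) u * scoord b (inl i) v).
Proof.
move=> sb; elim/(standard_ind sb): u => [l|a u u' h h'|]; last first.
- by rewrite linear0l big1 // => i _ /=; rewrite linear0l linear0r; ring.
- rewrite linearPl h h' mulr_sumr -big_split; apply: eq_bigr => i _.
  by rewrite !scoordP /=; ring.
under eq_bigr => j _ do rewrite !scoord_basis //.
case: l => i; rewrite (bigD1 i) // big1 => [|j ji].
- by rewrite Monoid.mulm1 eqxx -[inr i == inl i]/false /=; ring.
- by rewrite -[inl j == inl i]/(j == i) (negPf ji) -[inr j == inl i]/false /=; ring.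
- by rewrite Monoid.mulm1 eqxx -[inl i == inr i]/false /=; rewrite sform_skew; ring.
by rewrite -[inr j == inr i]/(j == i) (negPf ji) -[inl j == inr i]/false /=; ring.
Qed.

Lemma scoord_X b k u : scoord b (X k) u = sform u (b (Y k)).
Proof. by []. Qed.

Lemma scoord_Y b k u : scoord b (Y k) u = - sform u (b (X k)).
Proof. exact: sform_skew. Qed.

Lemma sform_coordXY b u v : standard_basis b ->
  sform u v =
    (scoord b (X 1) u * scoord b (Y 1) v - scoord b (Y 1) u * scoord b (X 1) v)
  + (scoord b (X 2) u * scoord b (Y 2) v - scoord b (Y 2) u * scoord b (X 2) v)
  + (scoord b (X 3) u * scoord b (Y 3) v - scoord b (Y 3) u * scoord b (X 3) v)
  + (scoord b (X 4) u * scoord b (Y 4) v - scoord b (Y 4) u * scoord b (X 4) v)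
  + (scoord b (X 5) u * scoord b (Y 5) v - scoord b (Y 5) u * scoord b (X 5) v).
Proof.
move=> sb; rewrite (sform_coord u v sb).
pose D k := scoord b (X k) u * scoord b (Y k) v - scoord b (Y k) u * scoord b (X k) v.
have e (i : 'I_5) : scoord b (inl i) u * scoord b (inr i) v
                  - scoord b (inr i) u * scoord b (inl i) v = D i.+1.
  by rewrite /D /X /Y inord_val.
by under eq_bigr do rewrite e; rewrite !big_ord_recr big_ord0 /= add0r.
Qed.

(** Membership of the basis vectors in L^2, L^3, Z_2 and Z_1, witnessed by explicit
products, so that it can be compared between two bases. *)
Lemma P36_products b r : is_P36 b r -> r != 0 ->
  [/\ b (Y 2) = smul (- r^-1 *: b (Y 4)) (b (Y 5)),
      b (X 1) = smul (b (Y 2)) (b (Y 5)),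
      b (Y 1) = smul (b (Y 2)) (- b (Y 4)),
      b (X 2) = smul (b (X 1)) (- b (Y 4))
    & (forall v w, smul (smul (b (X 2)) v) w = 0) /\
      forall k, (2 < k <= 5)%N -> forall v, smul (b (X k)) v = 0].
Proof.
move=> [sb bT] r0; split.
- apply: (standard_ext sb) => k /andP[]; case: k => [|[|[|[|[|[|k]]]]]] // _ _;
  rewrite (standard_YX, standard_YY) // linearZl_LR /= linearZl_LR /= bT /wedge
    !(scoord_basis _ _ sb) /X /Y !inord5E /=; by field.
- apply: (standard_ext sb) => k /andP[]; case: k => [|[|[|[|[|[|k]]]]]] // _ _;
  rewrite (standard_XX, standard_XY) // bT /wedge
    !(scoord_basis _ _ sb) /X /Y !inord5E /=; ring.
- apply: (standard_ext sb) => k /andP[]; case: k => [|[|[|[|[|[|k]]]]]] // _ _;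
  rewrite (standard_YX, standard_YY) // linearNr linearNl /= bT /wedge
    !(scoord_basis _ _ sb) /X /Y !inord5E /=; ring.
- apply: (standard_ext sb) => k /andP[]; case: k => [|[|[|[|[|[|k]]]]]] // _ _;
  rewrite (standard_XX, standard_XY) // linearNr linearNl /= bT /wedge
    !(scoord_basis _ _ sb) /X /Y !inord5E /=; ring.
split=> [v w|k kP v]; apply: sform_nondeg => z; rewrite bT /wedge.
  rewrite !scoord_X !scoord_Y !bT /wedge !(scoord_basis _ _ sb) /X /Y !inord5E /=; ring.
by case: k kP => [|[|[|[|[|[|k]]]]]] // _;
  rewrite !(scoord_basis _ _ sb) /X /Y !inord5E /=; ring.
Qed.

(** The orthogonality of the central series makes the matrix from b to c block
triangular; comparing determinants of its blocks leaves only a cube of freedom. *)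
Lemma P36_invariant b c r s : r != 0 -> s != 0 -> is_P36 b r -> is_P36 c s ->
  exists a, a != 0 /\ s / r = a ^+ 3.
Proof.
move=> r0 s0 Pb Pc.
have [by2 bx1 by1 bx2 [b2 bz]] := P36_products Pb r0.
have [cy2 cx1 cy1 cx2 [c2 cz]] := P36_products Pc s0.
case: Pb Pc => sb bT [sc cT].
have Z2 k : (1 < k <= 5)%N -> forall v w, smul (smul (b (X k)) v) w = 0.
  by case: k => [|[|[|k]]] // kP v w; rewrite bz // linear0l.
have z1 k : (1 < k <= 5)%N -> scoord b (Y k) (c (X 1)) = 0.
  by move=> kP; rewrite scoord_Y cx1 cy2 second_center_orth ?oppr0 //; apply: Z2.
have z2 k : (1 < k <= 5)%N -> scoord b (Y k) (c (Y 1)) = 0.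
  by move=> kP; rewrite scoord_Y cy1 cy2 second_center_orth ?oppr0 //; apply: Z2.
have z3 k : (0 < k <= 5)%N -> scoord b (Y k) (c (X 2)) = 0.
  case: k => [|[|k]] // kP.
    by rewrite /scoord /= -/(X 1) bx1 by2 second_center_orth.
  by rewrite scoord_Y cx2 cx1 second_center_orth ?oppr0 //; apply: Z2.
have z4 : scoord b (X 1) (c (X 2)) = 0.
  by rewrite scoord_X sform_skew by1 by2 second_center_orth ?oppr0.
have z5 k : (2 < k <= 5)%N -> scoord b (Y k) (c (Y 2)) = 0.
  by move=> kP; rewrite scoord_Y cy2 center_orth ?oppr0 //; apply: bz.
have {}z1 := (z1 2%N isT, z1 3%N isT, z1 4%N isT, z1 5%N isT).
have {}z2 := (z2 2%N isT, z2 3%N isT, z2 4%N isT, z2 5%N isT).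
have {}z5 := (z5 3%N isT, z5 4%N isT, z5 5%N isT).
pose lam := scoord b (Y 2) (c (Y 2)); pose kap := scoord b (X 2) (c (X 2)).
(* The value of (c_{x2}, c_{y2}). *)
have kl : kap * lam = 1.
  have := standard_XY (k := 2) (l := 2) sc isT isT.
  rewrite (sform_coordXY _ _ sb) !z3 // z4 !z5 // -/lam -/kap => h; apply: (etrans _ h); ring.
pose p := scoord b (X 1) (c (X 1)); pose q := scoord b (Y 1) (c (X 1)).
pose p' := scoord b (X 1) (c (Y 1)); pose q' := scoord b (Y 1) (c (Y 1)).
(* The value of (c_{x1}, c_{y1}). *)
have pq : p * q' - q * p' = 1.
  have := standard_XY (k := 1) (l := 1) sc isT isT.
  rewrite (sform_coordXY _ _ sb) !z1 // !z2 // -/p -/q -/p' -/q' => h; apply: (etrans _ h); ring.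
pose y44 := scoord b (Y 4) (c (Y 4)); pose y45 := scoord b (Y 4) (c (Y 5)).
pose y54 := scoord b (Y 5) (c (Y 4)); pose y55 := scoord b (Y 5) (c (Y 5)).
have es : r * kap * (y44 * y55 - y54 * y45) = s.
  transitivity (sform (smul (c (X 2)) (c (Y 4))) (c (Y 5))).
    by rewrite bT /wedge !z3 // z4 -/kap -/y44 -/y45 -/y54 -/y55; ring.
  rewrite cT /wedge !(scoord_basis _ _ sc) /X /Y !inord5E /=; ring.
have e11 : lam * (p * y44 + q * y54) = 1.
  transitivity (sform (smul (c (X 1)) (c (Y 2))) (c (Y 4))).
    by rewrite bT /wedge !z1 // !z5 // -/lam -/p -/q -/y44 -/y54; ring.
  rewrite cT /wedge !(scoord_basis _ _ sc) /X /Y !inord5E /=; ring.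
have e12 : lam * (p * y45 + q * y55) = 0.
  transitivity (sform (smul (c (X 1)) (c (Y 2))) (c (Y 5))).
    by rewrite bT /wedge !z1 // !z5 // -/lam -/p -/q -/y45 -/y55; ring.
  rewrite cT /wedge !(scoord_basis _ _ sc) /X /Y !inord5E /=; ring.
have e21 : lam * (p' * y44 + q' * y54) = 0.
  transitivity (sform (smul (c (Y 1)) (c (Y 2))) (c (Y 4))).
    by rewrite bT /wedge !z2 // !z5 // -/lam -/p' -/q' -/y44 -/y54; ring.
  rewrite cT /wedge !(scoord_basis _ _ sc) /X /Y !inord5E /=; ring.
have e22 : lam * (p' * y45 + q' * y55) = 1.
  transitivity (sform (smul (c (Y 1)) (c (Y 2))) (c (Y 5))).
    by rewrite bT /wedge !z2 // !z5 // -/lam -/p' -/q' -/y45 -/y55; ring.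
  rewrite cT /wedge !(scoord_basis _ _ sc) /X /Y !inord5E /=; ring.
(* The product of the two 2 x 2 matrices whose entries appear in e11 to e22 is
   the identity; take determinants. *)
have D1 : lam ^+ 2 * (y44 * y55 - y54 * y45) = 1.
  transitivity (lam * (p * y44 + q * y54) * (lam * (p' * y45 + q' * y55))
                - lam * (p * y45 + q * y55) * (lam * (p' * y44 + q' * y54))).
    by rewrite -[LHS]mulr1 -pq; ring.
  by rewrite e11 e22 e12 e21; ring.
exists kap; split.
  by apply: contra_eq_neq kl => ->; rewrite mul0r eq_sym oner_eq0.
have -> : s = r * kap ^+ 3.
  rewrite -es -[RHS]mulr1 -D1.
  transitivity (r * kap * (kap * lam) ^+ 2 * (y44 * y55 - y54 * y45)); last by ring.
  by rewrite kl; ring.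
by field.
Qed.

End P36Uniqueness.

(** * Equality of presented algebras *)

(** The weights 1, a, a, 1/a, 1/a on the x_i, with inverse weights on the y_i, fix the
three triples of value 1: the weights of their entries multiply to 1. *)
Lemma is_P36_rescale (F : fieldType) (L : saaType F) (b : label -> L) r a :
  a != 0 -> is_P36 b r -> exists c : label -> L, is_P36 c (r * a ^+ 3).
Proof.
move=> a0 [sb bT]; pose k (i : 'I_5) := nth 1 [:: 1; a; a; a^-1; a^-1] i.
have k0 i : k i != 0.
  by rewrite /k; case: i => -[|[|[|[|[|i]]]]] //= _; rewrite ?invr_eq0 ?oner_eq0.
pose c (l : label) := match l with inl i => k i *: b l | inr i => (k i)^-1 *: b l end.
have sc : standard_basis c.
  case: (sb) => _ xx yy xy.
  apply: standard_gram => [|i j|i j|i j]; first exact: standard_dim sb.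
  - by rewrite /c linearZl_LR linearZr_LR xx /= !mulr0.
  - by rewrite /c linearZl_LR linearZr_LR yy /= !mulr0.
  rewrite /c linearZl_LR linearZr_LR xy /=; have [->|_] := eqVneq i j; last by rewrite !mulr0.
  by rewrite mulr1 mulfV.
have cX n u : scoord c (X n) u = (k (inord n.-1))^-1 * scoord b (X n) u.
  by rewrite !scoord_X linearZr_LR.
have cY n u : scoord c (Y n) u = k (inord n.-1) * scoord b (Y n) u.
  by rewrite /scoord /= linearZl_LR.
exists c; split=> // u v w.
rewrite bT /wedge !(cX, cY) /k /= !inordK //=; rewrite invr1; by field.
Qed.

Lemma is_P36_iso (F : fieldType) (L M : saaType F) (b : label -> L) r (f : 'Hom(L, M)) :
  \dim {:M} = 10%N -> bijective f ->
  (forall u v, f (smul u v) = smul (f u) (f v)) ->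
  (forall u v, sform (f u) (f v) = sform u v) ->
  is_P36 b r -> is_P36 (f \o b) r.
Proof.
move=> dimM [g fK gK] fM fF [sb bT]; split.
  by case: (sb) => _ xx yy xy; apply: standard_gram => //= i j; rewrite fF.
have fc l u : scoord (f \o b) l u = scoord b l (g u).
  by case: l => i; rewrite /scoord /= -fF gK.
move=> u v w; rewrite /wedge !fc -[in LHS](gK u) -[in LHS](gK v) -[in LHS](gK w).
by rewrite -fM fF bT.
Qed.

Lemma P36_same_algebra (F : fieldType) (r s : F) : r != 0 -> s != 0 ->
  same_algebra (P36 r) (P36 s) <-> exists a : F, a != 0 /\ s / r = a ^+ 3.
Proof.
move=> r0 s0; split=> [[L [M [/has_presentation_P36[b Pb] /has_presentation_P36[c Pc]]]]|].
  case=> f [fB fM fF]; have dimM := standard_dim Pc.1.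
  exact: P36_invariant (is_P36_iso dimM fB fM fF Pb) Pc.
case=> a [a0 rs]; have Pr := model_presented (P36_separated r).
exists (model (P36 r)), (model (P36 r)); split=> //.
  case/has_presentation_P36: Pr => b /(is_P36_rescale a0)[c Pc].
  by apply/has_presentation_P36; exists c; rewrite -[s](divfK r0) rs mulrC.
exists \1%VF; split=> [|u v|u v]; rewrite ?id_lfunE //.
by exists id => u; rewrite id_lfunE.
Qed.

(** * Eigenvectors from the minimal polynomial *)

Section Horner.
Variables (F : fieldType) (V : vectType F) (f : 'End(V)).

Let pw i := iter i (comp_lfun f) \1%VF.

(** Padding the sum to a common length lets polynomials of different sizes be
compared termwise. *)
Lemma lfun_hornerE n (p : {poly F}) v : (size p <= n)%N ->
  lfun_horner f p v = \sum_(i < n) p`_i *: pw i v.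
Proof.
move=> pn; rewrite /lfun_horner (big_ord_widen n (fun i => p`_i *: pw i) pn).
rewrite sum_lfunE [in RHS](bigID (fun i : 'I_n => (i < size p)%N)) /=.
rewrite [X in _ = _ + X]big1 ?addr0 => [|i]; last first.
  by rewrite -leqNgt => ip; rewrite nth_default // scale0r.
by apply: eq_bigr => i _; rewrite scale_lfunE.
Qed.

Lemma lfun_horner_mulXsubC (q : {poly F}) (a : F) (v : V) :
  lfun_horner f (q * ('X - a%:P)) v = f (lfun_horner f q v) - a *: lfun_horner f q v.
Proof.
have sz : (size (q * ('X - a%:P))%R <= (size q).+1)%N.
  by apply: leq_trans (size_polyMleq _ _) _; rewrite size_XsubC addn2.
rewrite (lfun_hornerE v sz) [X in _ - a *: X](lfun_hornerE v (leqnSn _)).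
rewrite [in RHS](lfun_hornerE v (leqnn _)) linear_sum scaler_sumr /=.
transitivity (\sum_(i < (size q).+1) (if i == 0%N :> nat then 0 else q`_i.-1) *: pw i v
              - \sum_(i < (size q).+1) a *: (q`_i *: pw i v)).
  rewrite -sumrB; apply: eq_bigr => i _.
  by rewrite mulrBr coefB coefMX coefMC scalerA -scalerBl [a * _]mulrC.
congr (_ - _); rewrite big_ord_recl /= scale0r add0r.
by apply: eq_bigr => i _; rewrite linearZ /= lfunE.
Qed.

(** If p = q (X - a) then q(f) is nonzero by minimality, and f - a kills its image. *)
Lemma minpoly_root_eigenvector p a : is_minpoly f p -> root p a ->
  exists2 v, v != 0 & f v = a *: v.
Proof.
case=> pm p0 pmin /factor_theorem[q pq].
have q0 : q != 0.
  by apply: contraTneq pm => q0; rewrite pq q0 mul0r monicE lead_coef0 eq_sym oner_eq0.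
have [v nv] : exists v, lfun_horner f q v != 0.
  have : lfun_horner f q != 0.
    have : ~~ (size p <= size q)%N.
      by rewrite pq size_Mmonic ?monicXsubC // size_XsubC addn2 /= -ltnNge.
    by apply: contraNneq => /pmin/dvdp_leq; apply.
  move=> hq; have /subvPn[v _] : ~~ (fullv <= lker (lfun_horner f q))%VS.
    apply: contra hq => /subvP k; apply/eqP/lfunP => u.
    by rewrite lfunE; apply/eqP; rewrite -memv_ker k ?memvf.
  by rewrite memv_ker; exists v.
exists (lfun_horner f q v) => //.
have := lfun_horner_mulXsubC q a v; rewrite -pq p0 lfunE /= => /esym/eqP.
by rewrite subr_eq0 => /eqP.
Qed.

Lemma eigenvectors_indep (u v : V) a c k l : a != c ->
  u != 0 -> v != 0 -> f u = a *: u -> f v = c *: v ->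
  k *: u + l *: v = 0 -> k = 0 /\ l = 0.
Proof.
move=> ac u0 v0 fu fv e.
have e' : k *: (a *: u) + l *: (c *: v) = 0.
  by rewrite -fu -fv -!linearZ -linearD e linear0.
have l0 : l = 0.
  apply/eqP; have : (l * (c - a)) *: v = 0.
    rewrite -[RHS](subr0 0) -{1}e' -(scaler0 _ a) -e scalerDr !scalerA.
    rewrite opprD addrACA -!scalerBl mulrBr [a * k]mulrC subrr scale0r add0r.
    by rewrite [a * l]mulrC.
  move/eqP; rewrite scaler_eq0 (negPf v0) orbF mulf_eq0 subr_eq0 [c == a]eq_sym (negPf ac).
  by rewrite orbF.
split=> //; move/eqP: e; rewrite l0 scale0r addr0 scaler_eq0 (negPf u0) orbF.
by move/eqP.
Qed.
End Horner.

(** * The flag of central series *)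

Section Series.
Variables (F : fieldType) (L : saaType F).
Implicit Types (U V : {vspace L}) (u v w : L).

Lemma smulv_ind U V (Q : L -> Prop) :
  Q 0 -> (forall a u v, Q u -> Q v -> Q (a *: u + v)) ->
  (forall u v, u \in U -> v \in V -> Q (smul u v)) ->
  forall w, w \in smulv U V -> Q w.
Proof.
move=> Q0 Qlin Qm w; rewrite /smulv; set s := (X in <<X>>%VS) => ws.
rewrite (coord_span (X := in_tuple s) ws).
elim/big_rec: _ => // i v _ Qv; apply: Qlin => //.
have : (in_tuple s)`_i \in s by rewrite mem_nth.
by case/allpairsP=> -[p q] /= [/vbasis_mem pU /vbasis_mem qV ->]; apply: Qm.
Qed.

Lemma mem_smulv U V u v : u \in U -> v \in V -> smul u v \in smulv U V.
Proof. exact: (smulvP _ _ _ (subvv _)). Qed.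

(** Induction through (pq, v) = - (vq, p): multiplication moves one step of the
lower series into one step of the upper series. *)
Lemma lower_upper_orth m u v : u \in lower L m.+1 -> v \in upper L m -> sform u v = 0.
Proof.
elim: m u v => [|m IH] u v ul /=; first by rewrite memv0 => /eqP->; rewrite linear0r.
move/memv_upperS => vu; elim/(@smulv_ind (lower L m.+1) fullv): ul.
- by rewrite linear0l.
- by move=> a p q p0 q0; rewrite linearPl p0 q0 mulr0 addr0.
move=> p q pl _; rewrite sform_smul sform_skew smul_skew linearNr opprK.
exact: IH.
Qed.

Lemma lower_decr m : (lower L m.+2 <= lower L m.+1)%VS.
Proof.
elim: m => [|m IH]; first exact: subvf.
by apply/smulvP => u v /(subvP IH) ul _; apply: mem_smulv; rewrite ?memvf.
Qed.

Lemma upper_incr m : (upper L m <= upper L m.+1)%VS.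
Proof.
elim: m => [|m IH]; first exact: sub0v.
by apply/subvP => u /memv_upperS um; apply/memv_upperS => v; apply: (subvP IH).
Qed.

Lemma center_mul u v : u \in upper L 1 -> smul u v = 0.
Proof. by move/memv_upperS/(_ v); rewrite memv0 => /eqP. Qed.

(** The position of a label in the order x5, x4, x3, x2, x1, y1, ..., y5, which
refines the flag of central subspaces of an adapted basis. *)
Definition pos (l : label) : nat :=
  match l with inl i => 4 - i | inr i => 5 + i end.

Lemma pos_inj : injective pos.
Proof.
move=> [] i [] j; rewrite /pos; have := ltn_ord i; have := ltn_ord j => hj hi e.
- by congr inl; apply: val_inj => /=; lia.
- by lia.
- by lia.
by congr inr; apply: val_inj => /=; lia.
Qed.

Lemma pos_lt l : (pos l < 10)%N.
Proof. by case: l => i; rewrite /pos; have := ltn_ord i; lia. Qed.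

Definition lab (n : nat) : label := if (n < 5)%N then X (5 - n) else Y (n - 4).

Lemma posK : cancel pos lab.
Proof.
move=> l; apply: pos_inj; case: l => i; have := ltn_ord i; rewrite /lab /= => hi.
  by rewrite ifT /= ?inordK; lia.
by rewrite /= inordK; lia.
Qed.

Lemma pos_sorted_ind (D : label -> label -> label -> Prop) :
  (forall i j k, D i j k -> D j k i) -> (forall i j k, D i j k -> D j i k) ->
  (forall i k, D i i k) ->
  (forall i j k, (pos i < pos j < pos k)%N -> D i j k) ->
  forall i j k, D i j k.
Proof.
move=> cyc swp D2 Ds i j k.
case: (ltngtP (pos i) (pos j)) => [ij|ji|/pos_inj->]; last exact: D2.
  case: (ltngtP (pos j) (pos k)) => [jk|kj|/pos_inj<-]; last exact/cyc/cyc/D2.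
    by apply: Ds; rewrite ij.
  case: (ltngtP (pos i) (pos k)) => [ik|ki|/pos_inj<-]; last exact/cyc/D2.
    by apply/cyc/swp/Ds; rewrite ik.
  by apply/cyc/Ds; rewrite ki.
case: (ltngtP (pos j) (pos k)) => [jk|kj|/pos_inj<-]; last exact/cyc/cyc/D2.
  case: (ltngtP (pos i) (pos k)) => [ik|ki|/pos_inj<-]; last exact/cyc/D2.
    by apply/swp/Ds; rewrite ji.
  by apply/cyc/cyc/Ds; rewrite jk.
by apply/cyc/cyc/swp/Ds; rewrite kj.
Qed.

(** The smallest term of the central series that contains the basis vector at
position n, when the basis is adapted. *)
Definition flag (n : nat) : {vspace L} :=
  nth fullv [:: upper L 1; upper L 1; upper L 1; upper L 2;
                lower L 3; lower L 3; lower L 2; upper L 4] n.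

Definition flagged (b : label -> L) : Prop := forall l, b l \in flag (pos l).

Hypotheses (L3E : lower L 3 = upper L 3)
           (L3L2 : smulv (lower L 3) (lower L 2) = lower L 5).

Lemma flag_mono m n : (m <= n)%N -> (flag m <= flag n)%VS.
Proof.
move=> mn; rewrite -(subnK mn) addnC; elim: (n - m)%N => [|d IH]; first by rewrite addn0.
apply: subv_trans IH _; rewrite addnS.
case: (m + d)%N => [|[|[|[|[|[|[|[|k]]]]]]]]; rewrite ?subvv //; try exact: upper_incr.
- by rewrite [X in (_ <= X)%VS]L3E; apply: upper_incr.
- exact: lower_decr.
- apply/subvP => u uL; apply/memv_upperS => v; rewrite -L3E.
  by apply: mem_smulv; rewrite ?memvf.
- exact: subvf.
by rewrite /flag /= !nth_nil subvv.
Qed.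

Lemma flagged_le b l n : flagged b -> (pos l <= n)%N -> b l \in flag n.
Proof. by move=> fb /flag_mono/subvP; apply. Qed.

(** Z_4 L lies in Z_3 = L^3, which is orthogonal to Z_2. *)
Lemma upper2_upper4_mul u v : u \in upper L 2 -> v \in upper L 4 -> smul u v = 0.
Proof.
move=> uZ /memv_upperS vZ; apply: sform_nondeg => w; rewrite sform_smul.
by apply: (lower_upper_orth (m := 2)) => //; rewrite L3E.
Qed.

(** L^3 L = Z_3 L lies in Z_2, which is orthogonal to L^3. *)
Lemma lower3_mul u v : u \in lower L 3 -> v \in lower L 3 -> smul u v = 0.
Proof.
move=> uL; rewrite L3E => /memv_upperS vZ; apply: sform_nondeg => w.
by rewrite sform_smul sform_skew (lower_upper_orth (m := 2)) ?oppr0.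
Qed.

(** L^3 L^2 = L^5 is orthogonal to Z_4. *)
Lemma lower3_lower2_upper4 u v w : u \in lower L 3 -> v \in lower L 2 ->
  w \in upper L 4 -> sform (smul u v) w = 0.
Proof.
move=> uL vL; apply: lower_upper_orth; rewrite -L3L2; exact: mem_smulv.
Qed.

(** The outcome of diagonalizing tau, after a translation and a rescaling of y3 that
turn its eigenvalues into 0 (on x4) and 1 (on x5). *)
Definition diagonal (b : label -> L) : Prop :=
  [/\ standard_basis b, flagged b,
      smul (b (X 1)) (b (Y 2)) = b (X 4) /\ smul (b (X 1)) (b (Y 3)) = 0
    & smul (b (Y 1)) (b (Y 2)) = b (X 5) /\ smul (b (Y 1)) (b (Y 3)) = b (X 5)].

(** The orthogonality relations kill all triples except those whose positions are
listed in the proof; these are the hypotheses or the values of the presentation. *)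
Lemma diagonal_presented b : diagonal b ->
  (forall l, l \in [:: X 1; Y 1; Y 2; Y 3] ->
     sform (smul (b l) (b (Y 4))) (b (Y 5)) = 0) ->
  sform (smul (b (Y 2)) (b (Y 3))) (b (Y 4)) = 0 ->
  sform (smul (b (Y 2)) (b (Y 3))) (b (Y 5)) = 0 ->
  has_presentation L (P36 (sform (smul (b (X 2)) (b (Y 4))) (b (Y 5)))).
Proof.
case=> sb fb [x12 x13] [y12 y13] z45 z234 z235.
set r := sform _ _; exists b; split=> // [i j k a|].
  rewrite !inE => /or4P[] /eqP[-> -> -> ->] //.
  - by rewrite x12 standard_XY.
  - by rewrite y12 standard_XY.
  - by rewrite y13 standard_XY.
pose listed i j k := has (fun e : label * label * label * F =>
  perm_eq [:: i; j; k] [:: e.1.1.1; e.1.1.2; e.1.2]) (P36 r).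
pose D i j k := ~~ listed i j k -> sform (smul (b i) (b j)) (b k) = 0.
suff HD i j k : D i j k.
  move=> i j k np; apply: HD; apply/hasPn => -[[[i' j'] k'] a] /np //.
have [cyc swp] : (forall i j k, listed i j k = listed j k i)
              /\ (forall i j k, listed i j k = listed j i k).
  split=> {}i {}j {}k; apply: eq_has => e.
    exact: (perm_catC [:: i] [:: j; k]).
  exact: (perm_catCA [:: i] [:: j] [:: k]).
move: i j k; apply: pos_sorted_ind => [i j k|i j k|i k|i j k]; rewrite /D.
- by move=> h np; rewrite -sform_smul h // cyc.
- by move=> h np; rewrite triple_swap h ?oppr0 // swp.
- by rewrite smul_alt linear0l.
move=> ijk np; have kl := pos_lt k.
have [i2|i2] := leqP (pos i) 2.
  by rewrite center_mul ?linear0l // (flagged_le fb i2).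
have [ij|ij] := boolP ((pos i <= 3) && (pos j <= 7))%N.
  case/andP: ij => i3 j7.
  by rewrite upper2_upper4_mul ?linear0l // ?(flagged_le fb i3) ?(flagged_le fb j7).
have [j5|j5] := leqP (pos j) 5.
  have i5 : (pos i <= 5)%N by lia.
  by rewrite lower3_mul ?linear0l // ?(flagged_le fb i5) ?(flagged_le fb j5).
have [/and3P[i5 j6 k7]|ijk'] := boolP [&& pos i <= 5, pos j <= 6 & pos k <= 7]%N.
  by rewrite lower3_lower2_upper4 // ?(flagged_le fb i5) ?(flagged_le fb j6) ?(flagged_le fb k7).
move: np; rewrite -(posK i) -(posK j) -(posK k).
move: (pos i) (pos j) (pos k) ijk kl i2 ij j5 ijk' => m n p mnp p10 m2 mn n5 mnp'.
have : [|| [&& m == 3, n == 8 & p == 9],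
           [&& (m == 4) || (m == 5), (n == 6) || (n == 7) & (p == 8) || (p == 9)],
           [&& m == 6, n == 7 & (p == 8) || (p == 9)]
         | [&& [|| m == 4, m == 5, m == 6 | m == 7], n == 8 & p == 9]]%N.
  lia.
have no (i' j' k' : label) a (Q : Prop) : (i', j', k', a) \in P36 r -> ~~ listed i' j' k' -> Q.
  by move=> Pa /hasPn/(_ _ Pa); rewrite perm_refl.
case/or4P.
- case/and3P=> /eqP-> /eqP-> /eqP->.
  by apply: (no _ _ _ r); rewrite !inE eqxx.
- case/and3P=> /orP[]/eqP-> /orP[]/eqP-> /orP[]/eqP->.
  + by apply: (no _ _ _ 1); rewrite !inE eqxx ?orbT.
  + by rewrite -[sform _ _]/(sform (smul (b (X 1)) (b (Y 2))) (b (Y 5))) x12 standard_XY.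
  + by rewrite -[sform _ _]/(sform (smul (b (X 1)) (b (Y 3))) (b (Y 4))) x13 linear0l.
  + by rewrite -[sform _ _]/(sform (smul (b (X 1)) (b (Y 3))) (b (Y 5))) x13 linear0l.
  + by rewrite -[sform _ _]/(sform (smul (b (Y 1)) (b (Y 2))) (b (Y 4))) y12 standard_XY.
  + by apply: (no _ _ _ 1); rewrite !inE eqxx ?orbT.
  + by rewrite -[sform _ _]/(sform (smul (b (Y 1)) (b (Y 3))) (b (Y 4))) y13 standard_XY.
  + by apply: (no _ _ _ 1); rewrite !inE eqxx ?orbT.
- by case/and3P=> /eqP-> /eqP-> /orP[]/eqP->.
case/and3P=> mE /eqP-> /eqP-> _.
apply: (z45 (lab m)); rewrite !inE.
by case/or4P: mE => /eqP->; rewrite eqxx ?orbT.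
Qed.

(** If the value were 0 then x2 would be central, hence orthogonal to L^2, but
(x2, y2) = 1 and y2 lies in L^2. *)
Lemma flagged_triple_neq0 b : standard_basis b -> flagged b ->
  sform (smul (b (X 2)) (b (Y 4))) (b (Y 5)) != 0.
Proof.
move=> sb fb; apply/eqP => r0.
have pos_XY k : (0 < k <= 5)%N -> pos (X k) = (5 - k)%N /\ pos (Y k) = (4 + k)%N.
  by move=> kP; rewrite /pos /= inordK; lia.
have x2 : b (X 2) \in upper L 2 by have := fb (X 2); rewrite (pos_XY 2%N isT).1.
have y2 : b (Y 2) \in lower L 2 by have := fb (Y 2); rewrite (pos_XY 2%N isT).2.
have T0 l m : sform (smul (b (X 2)) (b l)) (b m) = 0.
  have [l7|l7] := leqP (pos l) 7.
    by rewrite upper2_upper4_mul ?linear0l ?(flagged_le fb l7).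
  have [m7|m7] := leqP (pos m) 7.
    by rewrite 2!sform_smul smul_skew upper2_upper4_mul ?oppr0 ?linear0l ?(flagged_le fb m7).
  have Y45 n : (7 < pos n)%N -> n = Y 4 \/ n = Y 5.
    move=> n7; have := pos_lt n => n10.
    have /orP[] : (pos n == 8) || (pos n == 9) by lia.
      by move/eqP => nE; left; rewrite -(posK n) nE.
    by move/eqP => nE; right; rewrite -(posK n) nE.
  case: (Y45 l l7) => ->; case: (Y45 m m7) => ->.
  - by rewrite sform_smul smul_alt linear0l.
  - exact: r0.
  - by rewrite sform_smul smul_skew linearNl -sform_smul r0 oppr0.
  by rewrite sform_smul smul_alt linear0l.
have x2Z : b (X 2) \in upper L 1.
  apply/memv_upperS => v; rewrite memv0; apply/eqP; apply: sform_nondeg => w.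
  elim/(standard_ind sb): v => [l|a v v' h h'|]; last by rewrite linear0r linear0l.
    elim/(standard_ind sb): w => [m|a w w' h h'|]; [exact: T0 | | exact: linear0r].
    by rewrite linearPr h h' mulr0 addr0.
  by rewrite linearPr linearPl h h' mulr0 addr0.
have := standard_XY (k := 2) (l := 2) sb isT isT.
rewrite sform_skew (lower_upper_orth (m := 1) y2 x2Z) oppr0 => /esym/eqP.
by rewrite oner_eq0.
Qed.
End Series.

(** * Eigenvectors of an algebra of type A *)

(** If the determinant vanished, the rows of the adjugate matrix would give linear
relations between f1 and f2. *)
Lemma det2_neq0 (F : fieldType) (V : lmodType F) (e1 e2 f1 f2 : V) A B C D :
  f1 = A *: e1 + B *: e2 -> f2 = C *: e1 + D *: e2 ->
  (forall k l, k *: f1 + l *: f2 = 0 -> k = 0 /\ l = 0) ->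
  A * D - B * C != 0.
Proof.
move=> ef1 ef2 indep; apply/eqP => d0.
have comb k l : k *: f1 + l *: f2 = (k * A + l * C) *: e1 + (k * B + l * D) *: e2.
  by rewrite ef1 ef2 !scalerDr !scalerA addrACA -!scalerDl.
have [D0 B0] : D = 0 /\ - B = 0.
  apply: indep; rewrite comb.
  have -> : D * A + - B * C = A * D - B * C by ring.
  by rewrite d0 scale0r add0r [X in X *: _](_ : _ = 0) ?scale0r //; ring.
have [C0 A0] : - C = 0 /\ A = 0.
  apply: indep; rewrite comb.
  have -> : - C * B + A * D = A * D - B * C by ring.
  by rewrite d0 scale0r addr0 [X in X *: _](_ : _ = 0) ?scale0r //; ring.
have [/eqP] : (1 : F) = 0 /\ (0 : F) = 0; last by rewrite oner_eq0.
apply: indep; rewrite comb A0 -[B]opprK B0 -[C]opprK C0 D0 oppr0.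
by rewrite !mulr0 !addr0 !scale0r addr0.
Qed.

Definition basis_of_seqs (F : fieldType) (L : lmodType F) (xs ys : seq L) (l : label) : L :=
  match l with inl i => nth 0 xs i | inr i => nth 0 ys i end.

Section TypeABasis.
Variables (F : fieldType) (L : saaType F).
Implicit Types (b : label -> L) (u v w : L).

Lemma adapted_flagged b : adapted_basis b -> flagged b.
Proof.
case=> _ l5 zE [l4 z2E] [l3 z3E l2E z4E] l.
rewrite -(posK l); have := pos_lt l; move: (pos l) => n n10.
have posl : pos (lab n) = n.
  by rewrite /lab; case: ltnP => h /=; rewrite inordK; lia.
rewrite posl; case: n n10 {posl} => [|[|[|[|[|[|[|[|n]]]]]]]] n10.
- rewrite -[_ \in _]/(b (X 5) \in center L) zE l5; apply: subvP (memv_line _).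
  exact: subv_trans (addvSl _ _) (addvSl _ _).
- rewrite -[_ \in _]/(b (X 4) \in center L) zE l5; apply: subvP (memv_line _).
  exact: subv_trans (addvSr _ _) (addvSl _ _).
- by rewrite -[_ \in _]/(b (X 3) \in center L) zE (subvP (addvSr _ _)) ?memv_line.
- by rewrite -[_ \in _]/(b (X 2) \in upper L 2) z2E (subvP (addvSr _ _)) ?memv_line.
- rewrite -[_ \in _]/(b (X 1) \in lower L 3) l3 z3E; apply: subvP (memv_line _).
  exact: subv_trans (addvSr _ _) (addvSl _ _).
- rewrite -[_ \in _]/(b (Y 1) \in lower L 3) l3 z3E.
  by rewrite (subvP (addvSr _ _)) ?memv_line.
- by rewrite -[_ \in _]/(b (Y 2) \in lower L 2) l2E (subvP (addvSr _ _)) ?memv_line.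
- by rewrite -[_ \in _]/(b (Y 3) \in upper L 4) z4E (subvP (addvSr _ _)) ?memv_line.
by rewrite /flag nth_default ?memvf.
Qed.

Hypotheses (L3E : lower L 3 = upper L 3)
           (L3L2 : smulv (lower L 3) (lower L 2) = lower L 5).

(** Because L^3 L^2 = L^5 and L^3 L^3 = 0, multiplication by y2 maps L^3 onto L^5;
the component in L^4 of a preimage is killed by y2 and y3, so a preimage can be
chosen in <x1, y1>. *)
Lemma adapted_lift b phi psi (w : subvs_of (lower L 5)) :
  adapted_basis b -> is_quot_rmul (b (Y 2)) phi -> is_quot_rmul (b (Y 3)) psi ->
  exists p q, let u := p *: b (X 1) + q *: b (Y 1) in
    smul u (b (Y 2)) = vsval w /\ smul u (b (Y 3)) = vsval ((psi \o phi^-1)%VF w).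
Proof.
move=> ab phiE psiE; have fb := adapted_flagged ab.
case: (ab) => sb l5 zE [l4 z2E] [l3 z3E l2E z4E].
have y2 : b (Y 2) \in lower L 2 by rewrite l2E (subvP (addvSr _ _)) ?memv_line.
have y3 : b (Y 3) \in upper L 4 by rewrite z4E (subvP (addvSr _ _)) ?memv_line.
have y24 : b (Y 2) \in upper L 4 by rewrite z4E (subvP (addvSl _ _)).
have phi_surj z : z \in lower L 5 -> exists2 u, u \in lower L 3 & smul u (b (Y 2)) = z.
  rewrite -L3L2 => zL; elim/(@smulv_ind _ _ (lower L 3) (lower L 2)): zL.
  - by exists 0; rewrite ?mem0v ?linear0l.
  - move=> a _ _ [u uL <-] [v vL <-]; exists (a *: u + v).
      by rewrite memvD ?memvZ.
    by rewrite linearPl.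
  move=> u v uL; rewrite l2E => /memv_addP[v1 v1L [_ /vlineP[k ->] ->]].
  exists (k *: u); first by rewrite memvZ.
  by rewrite linearDr linearZl_LR linearZr_LR /= (lower3_mul L3E uL v1L) add0r.
have wphi : w \in limg phi.
  have [u uL uw] := phi_surj _ (subvsP w).
  have -> : w = phi (quotv_proj (lower L 3) (lower L 4) u).
    by apply: val_inj; rewrite /= -[RHS]/(vsval _) phiE.
  by apply: memv_img; apply: memvf.
have [u uL pu] := quotv_proj_surj (phi^-1%VF w).
have u2 : smul u (b (Y 2)) = vsval w by rewrite -phiE // pu limg_lfunVK.
have u3 : smul u (b (Y 3)) = vsval ((psi \o phi^-1)%VF w).
  by rewrite -psiE // pu comp_lfunE.
have : u \in (upper L 2 + <[b (X 1)]> + <[b (Y 1)]>)%VS by rewrite -l4 -z3E -l3.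
case/memv_addP=> [_ /memv_addP[z zZ [_ /vlineP[p ->] ->]] [_ /vlineP[q ->] eu]].
exists p, q => /=.
have e : u = z + (p *: b (X 1) + q *: b (Y 1)) by rewrite eu addrA.
split; [rewrite -u2 | rewrite -u3]; rewrite e [in RHS]linearDl /=.
  by rewrite [smul z _](upper2_upper4_mul L3E) ?add0r.
by rewrite [smul z _](upper2_upper4_mul L3E) ?add0r.
Qed.

End TypeABasis.

(** The vectors u and v are the preimages of eigenvectors of tau for distinct
eigenvalues under multiplication by y2; independence of the images gives
independence of u, v. *)
Lemma type_A_eigen (F : fieldType) (L : saaType F) :
  smulv (lower L 3) (lower L 2) = lower L 5 -> type_A L ->
  exists b : label -> L, adapted_basis b /\
  exists (p q p' q' A B C D al ga : F),
  [/\ al != ga, p * q' - q * p' != 0, A * D - B * C != 0,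
    let u := p *: b (X 1) + q *: b (Y 1) in
      smul u (b (Y 2)) = A *: b (X 4) + B *: b (X 5) /\
      smul u (b (Y 3)) = al *: smul u (b (Y 2))
  & let v := p' *: b (X 1) + q' *: b (Y 1) in
      smul v (b (Y 2)) = C *: b (X 4) + D *: b (X 5) /\
      smul v (b (Y 3)) = ga *: smul v (b (Y 2))].
Proof.
move=> L3L2 [b [phi [psi [ab phiE psiE [P [Pm [al [ga [alga ra rc]]]]]]]]].
exists b; split=> //; have [_ l5 _ _ [L3E _ _ _]] := ab.
have [w w0 we] := minpoly_root_eigenvector Pm ra.
have [w' w0' we'] := minpoly_root_eigenvector Pm rc.
have [p [q [u2 u3]]] := adapted_lift L3E L3L2 w ab phiE psiE.
have [p' [q' [v2 v3]]] := adapted_lift L3E L3L2 w' ab phiE psiE.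
have co z : z \in lower L 5 -> exists A B, z = A *: b (X 4) + B *: b (X 5).
  rewrite l5 => /memv_addP[_ /vlineP[B ->] [_ /vlineP[A ->] ->]].
  by exists A, B; rewrite addrC.
have [A [B wAB]] := co _ (subvsP w); have [C [D wCD]] := co _ (subvsP w').
have ind k l : k *: vsval w + l *: vsval w' = 0 -> k = 0 /\ l = 0.
  rewrite -!linearZ -linearD => e.
  apply: (eigenvectors_indep alga w0 w0' we we').
  by apply: val_inj; rewrite [LHS]e linear0.
exists p, q, p', q', A, B, C, D, al, ga; split=> //.
- apply: (det2_neq0 (e1 := b (X 1)) (e2 := b (Y 1)) erefl erefl) => k l e.
  apply: ind; rewrite -u2 -v2.
  have := congr1 (fun z => smul z (b (Y 2))) e.
  by rewrite linear0l linearPl linearZl_LR.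
- exact: det2_neq0 wAB wCD ind.
- by move=> u; split; rewrite /u ?u3 u2 // we linearZ.
by move=> v; split; rewrite /v ?v3 v2 // we' linearZ.
Qed.

(** * Reduction to the normal form *)

Section Reduction.
Variables (F : fieldType) (L : saaType F).
Implicit Types (b : label -> L) (u v w : L) (xs ys : seq L).

Lemma basis_of_seqsX xs ys k : (0 < k <= 5)%N -> basis_of_seqs xs ys (X k) = nth 0 xs k.-1.
Proof. by move=> kP; rewrite /= inordK //; lia. Qed.

Lemma basis_of_seqsY xs ys k : (0 < k <= 5)%N -> basis_of_seqs xs ys (Y k) = nth 0 ys k.-1.
Proof. by move=> kP; rewrite /= inordK //; lia. Qed.

Lemma standard_of_seqs xs ys : \dim {:L} = 10%N ->
  (forall i j, (i < j)%N -> (j < 5)%N -> sform (nth 0 xs i) (nth 0 xs j) = 0) ->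
  (forall i j, (i < j)%N -> (j < 5)%N -> sform (nth 0 ys i) (nth 0 ys j) = 0) ->
  (forall i j, (i < 5)%N -> (j < 5)%N -> sform (nth 0 xs i) (nth 0 ys j) = (i == j)%:R) ->
  standard_basis (basis_of_seqs xs ys).
Proof.
move=> dimL xx yy xy; apply: standard_gram => // i j; last by rewrite /= xy.
  case: (ltngtP i j) => [ij|ji|/val_inj->]; last exact: sform_alt.
    by rewrite /= xx.
  by rewrite sform_skew /= xx ?oppr0.
case: (ltngtP i j) => [ij|ji|/val_inj->]; last exact: sform_alt.
  by rewrite /= yy.
by rewrite sform_skew /= yy ?oppr0.
Qed.

Lemma flagged_of_seqs xs ys :
  (forall k, (0 < k <= 5)%N -> nth 0 xs k.-1 \in flag L (5 - k)) ->
  (forall k, (0 < k <= 5)%N -> nth 0 ys k.-1 \in flag L (4 + k)) ->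
  flagged (basis_of_seqs xs ys).
Proof.
move=> hx hy [] i; have := ltn_ord i => hi /=.
  by have := hx i.+1; rewrite subSS; apply.
by have := hy i.+1; rewrite addnS; apply.
Qed.

Lemma sformDl u u' v : sform (u + u') v = sform u v + sform u' v.
Proof. exact: linearDl. Qed.
Lemma sformDr u v v' : sform u (v + v') = sform u v + sform u v'.
Proof. exact: linearDr. Qed.
Lemma sformZl a u v : sform (a *: u) v = a * sform u v.
Proof. exact: linearZl_LR. Qed.
Lemma sformZr a u v : sform u (a *: v) = a * sform u v.
Proof. exact: linearZr_LR. Qed.
Lemma sform0l v : sform (0 : L) v = 0.
Proof. exact: linear0l. Qed.
Lemma smulDl u u' v : smul (u + u') v = smul u v + smul u' v.
Proof. exact: linearDl. Qed.
Lemma smulDr u v v' : smul u (v + v') = smul u v + smul u v'.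
Proof. exact: linearDr. Qed.
Lemma smulZl a u v : smul (a *: u) v = a *: smul u v.
Proof. exact: linearZl_LR. Qed.
Lemma smulZr a u v : smul u (a *: v) = a *: smul u v.
Proof. exact: linearZr_LR. Qed.

Definition sformE := (sformDl, sformDr, sformZl, sformZr, sform0l).
Definition smulE := (smulDl, smulDr, smulZl, smulZr).

Hypothesis L3E : lower L 3 = upper L 3.

(** The first disjunct holds because x5, x4, x3 share one term of the flag, the
center. *)
Lemma flaggedX b k n : flagged b -> (0 < k <= 5)%N -> (2 < k)%N || (5 - k <= n)%N ->
  b (X k) \in flag L n.
Proof.
move=> fb kP; have pk : pos (X k) = (5 - k)%N by rewrite /= inordK; lia.
case/orP=> kn; last by apply: flagged_le => //; rewrite pk.
have : b (X k) \in flag L 2 by apply: flagged_le => //; rewrite pk; lia.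
exact: subvP (flag_mono L3E (leq0n n)) _.
Qed.

(** The term L^3 at position 4 already contains y1, and past position 7 the term is
the whole space. *)
Lemma flaggedY b k n : flagged b -> (0 < k <= 5)%N ->
  [|| (k == 1%N) && (n == 4%N), 7 < n | 4 + k <= n]%N -> b (Y k) \in flag L n.
Proof.
move=> fb kP; have pk : pos (Y k) = (4 + k)%N by rewrite /= inordK; lia.
case/or3P=> [/andP[/eqP-> /eqP->]|n7|kn]; last by apply: flagged_le => //; rewrite pk.
  by have : b (Y 1) \in flag L 5 by apply: flagged_le => //; rewrite /= inordK.
by apply: subvP (flag_mono L3E n7) _ _; rewrite memvf.
Qed.

(** The new x1, y1 are u and d^-1 v, where d is the determinant (u, v), and x4, x5 are
their products with y2.  The remaining vectors restore the standard relations: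
y4, y5 by the inverse matrix, and x2, x3 in answer to the change of y3. *)
Lemma diagonal_exists b (p q p' q' A B C D al ga : F) :
  adapted_basis b ->
  al != ga -> p * q' - q * p' != 0 -> A * D - B * C != 0 ->
  (let u := p *: b (X 1) + q *: b (Y 1) in
      smul u (b (Y 2)) = A *: b (X 4) + B *: b (X 5) /\
      smul u (b (Y 3)) = al *: smul u (b (Y 2))) ->
  (let v := p' *: b (X 1) + q' *: b (Y 1) in
      smul v (b (Y 2)) = C *: b (X 4) + D *: b (X 5) /\
      smul v (b (Y 3)) = ga *: smul v (b (Y 2))) ->
  exists b', diagonal b'.
Proof.
move=> ab alga d0 e0; set u := p *: _ + _ => -[u2 u3]; set v := p' *: _ + _ => -[v2 v3].
have fb := adapted_flagged ab; have [sb _ _ _ _] := ab.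
have k0 : ga - al != 0 by rewrite subr_eq0 eq_sym.
set d := p * q' - q * p' in d0; set e := A * D - B * C in e0.
pose xs := [:: u; b (X 2) + al *: b (X 3); (ga - al) *: b (X 3);
               A *: b (X 4) + B *: b (X 5);
               (d^-1 * C) *: b (X 4) + (d^-1 * D) *: b (X 5)].
pose ys := [:: d^-1 *: v; b (Y 2); (ga - al)^-1 *: b (Y 3) + (- (ga - al)^-1 * al) *: b (Y 2);
               (e^-1 * D) *: b (Y 4) + (- e^-1 * C) *: b (Y 5);
               (d * - e^-1 * B) *: b (Y 4) + (d * e^-1 * A) *: b (Y 5)].
exists (basis_of_seqs xs ys).
have GXX k l := standard_XX k l sb; have GYY k l := standard_YY k l sb.
have GXY k l := standard_XY (k := k) (l := l) sb.
have GYX k l := standard_YX (k := k) (l := l) sb.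
split.
- apply: standard_of_seqs => [|i j|i j|i j]; first exact: standard_dim sb.
  + case: i j => [|[|[|[|[|i]]]]] [|[|[|[|[|j]]]]] //= _ _;
      rewrite /u /v ?sformE ?(GXX, GYY, GXY, GYX) //=; ring.
  + case: i j => [|[|[|[|[|i]]]]] [|[|[|[|[|j]]]]] //= _ _;
      rewrite /u /v ?sformE ?(GXX, GYY, GXY, GYX) //=; ring.
  case: i j => [|[|[|[|[|i]]]]] [|[|[|[|[|j]]]]] //= _ _;
    rewrite /u /v ?sformE ?(GXX, GYY, GXY, GYX) //=; first [by ring | by field |
      by rewrite /d /e; rewrite /d in d0; rewrite /e in e0; field; rewrite ?d0 ?e0].
- apply: flagged_of_seqs => -[|[|[|[|[|[|k]]]]]] //= _; rewrite /u /v;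
    do ?[apply: memvD | apply: memvZ]; first [exact: flaggedX | exact: flaggedY].
- rewrite !basis_of_seqsX ?basis_of_seqsY // /xs /ys /=; split; first exact: u2.
  by rewrite smulDr !smulZr u3 u2 scalerA -scalerDl mulNr addrN scale0r.
rewrite !basis_of_seqsX ?basis_of_seqsY // /xs /ys /=; split.
  by rewrite smulZl v2 scalerDr !scalerA.
rewrite smulZl smulDr !smulZr v3 v2 scalerA -scalerDl.
by rewrite mulNr -mulrBr mulVf // scale1r scalerDr !scalerA.
Qed.

(** With r = (x2 y4, y5), adding multiples of x2 shifts the triples ending in y4, y5
by multiples of r.  Adding c x1 + d y1 to y3 changes (y2 y3, y4) by - c and
(y2 y3, y5) by - d.  The other terms, all in L^3, keep the basis standard; among
them the multiple of y1 in y2 accounts for the summand al / r of d. *)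
Lemma diagonal_normalize b : diagonal b ->
  exists b', diagonal b' /\
  [/\ forall l, l \in [:: X 1; Y 1; Y 2; Y 3] ->
        sform (smul (b' l) (b' (Y 4))) (b' (Y 5)) = 0,
      sform (smul (b' (Y 2)) (b' (Y 3))) (b' (Y 4)) = 0
    & sform (smul (b' (Y 2)) (b' (Y 3))) (b' (Y 5)) = 0].
Proof.
case=> sb fb [x12 x13] [y12 y13].
pose T u v w := sform (smul u v) w.
pose r := T (b (X 2)) (b (Y 4)) (b (Y 5)).
have r0 : r != 0 := flagged_triple_neq0 L3E sb fb.
pose al := T (b (X 1)) (b (Y 4)) (b (Y 5)); pose be := T (b (Y 1)) (b (Y 4)) (b (Y 5)).
pose c := T (b (Y 2)) (b (Y 3)) (b (Y 4)).
pose d := T (b (Y 2)) (b (Y 3)) (b (Y 5)) + al / r.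
pose e := T (b (Y 2)) (b (Y 4)) (b (Y 5)).
pose z := - (T (b (Y 3)) (b (Y 4)) (b (Y 5)) + c * al + d * be) / r.
pose xs := [:: b (X 1) + (- (al / r)) *: b (X 2) + (- d) *: b (X 3);
               b (X 2); b (X 3); b (X 4); b (X 5)].
pose ys := [:: b (Y 1) + (- (be / r)) *: b (X 2) + c *: b (X 3);
               b (Y 2) + (al / r) *: b (Y 1) + (- (be / r)) *: b (X 1)
                 + (- (e / r)) *: b (X 2) + (z + al * c / r + be * d / r) *: b (X 3);
               b (Y 3) + c *: b (X 1) + d *: b (Y 1) + z *: b (X 2);
               b (Y 4); b (Y 5)].
have GXX k l := standard_XX k l sb; have GYY k l := standard_YY k l sb.
have GXY k l := standard_XY (k := k) (l := l) sb.
have GYX k l := standard_YX (k := k) (l := l) sb.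
have low k : (0 < k <= 5)%N -> b (X k) \in lower L 3.
  by move=> kP; apply: (flaggedX (n := 5)) => //; lia.
have y1L : b (Y 1) \in lower L 3 by apply: (flaggedY (n := 5)).
have x2Z : b (X 2) \in upper L 2 by apply: (flaggedX (n := 3)).
have x3Z : b (X 3) \in upper L 1 by apply: (flaggedX (n := 2)).
have y2Z : b (Y 2) \in upper L 4 by apply: (flaggedY (n := 7)).
have y3Z : b (Y 3) \in upper L 4 by apply: (flaggedY (n := 7)).
have MXX k l : (0 < k <= 5)%N -> (0 < l <= 5)%N -> smul (b (X k)) (b (X l)) = 0.
  by move=> kP lP; rewrite (lower3_mul L3E) ?low.
have M0 : ((smul (b (X 1)) (b (Y 1)) = 0) * (smul (b (Y 1)) (b (X 1)) = 0)
  * (smul (b (Y 1)) (b (X 2)) = 0) * (smul (b (X 2)) (b (Y 1)) = 0)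
  * (smul (b (X 2)) (b (Y 2)) = 0) * (smul (b (X 2)) (b (Y 3)) = 0)
  * (smul (b (Y 2)) (b (X 2)) = 0) * (smul (b (Y 1)) (b (Y 1)) = 0))%type.
  do !split; try exact: smul_alt;
    first [by rewrite (lower3_mul L3E) ?low | by rewrite (upper2_upper4_mul L3E)
          | by rewrite smul_skew (upper2_upper4_mul L3E) ?oppr0].
have M3 v : smul (b (X 3)) v = 0 by apply: center_mul.
have M3r v : smul v (b (X 3)) = 0 by rewrite smul_skew M3 oppr0.
have M21 : smul (b (Y 2)) (b (X 1)) = (-1) *: b (X 4).
  by rewrite smul_skew x12 scaleN1r.
have M22 : smul (b (Y 2)) (b (Y 1)) = (-1) *: b (X 5).
  by rewrite smul_skew y12 scaleN1r.
have M := (x12, x13, y12, y13, M0, M3, M3r, M21, M22).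
exists (basis_of_seqs xs ys); split; last first.
  split=> [l||].
  - rewrite !inE => /or4P[] /eqP->; rewrite !(basis_of_seqsX, basis_of_seqsY) // /xs /ys /=;
      rewrite ?smulE ?M ?sformE ?M -![sform (smul _ _) _]/(T _ _ _) -/r -/al -/be -/e;
      rewrite ?sform0l /z /d /=; by field.
  - rewrite !(basis_of_seqsX, basis_of_seqsY) // /xs /ys /=.
    rewrite ?smulE ?M ?MXX // ?scaler0 ?addr0 ?add0r ?sformE !GXY //=.
    by rewrite /c /T; ring.
  rewrite !(basis_of_seqsX, basis_of_seqsY) // /xs /ys /=.
  rewrite ?smulE ?M ?MXX // ?scaler0 ?addr0 ?add0r ?sformE !GXY //=.
  by rewrite /d /T; ring.
split.
- apply: standard_of_seqs => [|i j|i j|i j]; first exact: standard_dim sb.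
  + by case: i j => [|[|[|[|[|i]]]]] [|[|[|[|[|j]]]]] //= _ _;
      rewrite ?sformE ?(GXX, GYY, GXY, GYX) //=; ring.
  + case: i j => [|[|[|[|[|i]]]]] [|[|[|[|[|j]]]]] //= _ _;
      rewrite ?sformE ?(GXX, GYY, GXY, GYX) //=; by field.
  by case: i j => [|[|[|[|[|i]]]]] [|[|[|[|[|j]]]]] //= _ _;
    rewrite ?sformE ?(GXX, GYY, GXY, GYX) //=; ring.
- apply: flagged_of_seqs => -[|[|[|[|[|[|k]]]]]] //= _;
    do ?[apply: memvD | apply: memvZ]; first [exact: flaggedX | exact: flaggedY].
- rewrite !(basis_of_seqsX, basis_of_seqsY) // /xs /ys /=.
  by rewrite ?smulE ?M ?MXX // ?scaler0 ?addr0 ?add0r.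
rewrite !(basis_of_seqsX, basis_of_seqsY) // /xs /ys /=.
by rewrite ?smulE ?M ?MXX // ?scaler0 ?addr0 ?add0r.
Qed.
End Reduction.

Theorem proposition7p13 (F : fieldType) :
  (forall L : saaType F,
     nilpotent_saa L -> \dim {:L} = 10%N ->
     isotropic (center L) -> \dim (center L) = 3%N ->
     \dim (lower L 3) = 6%N ->
     smulv (lower L 3) (lower L 2) = lower L 5 ->
     type_A L ->
     exists r : F, r != 0 /\ has_presentation L (P36 r))
  /\
  (forall r s : F, r != 0 -> s != 0 ->
     same_algebra (P36 r) (P36 s) <-> exists a : F, a != 0 /\ s / r = a ^+ 3).
Proof.
split=> [L _ _ _ _ _ L3L2 LA|]; last exact: P36_same_algebra.
have [b [ab [p [q [p' [q' [A [B [C [D [al [ga [alga d0 e0 uE vE]]]]]]]]]]]]] :=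
  type_A_eigen L3L2 LA.
have [_ _ _ _ [L3E _ _ _]] := ab.
have [b1 b1D] := diagonal_exists L3E ab alga d0 e0 uE vE.
have [b2 [b2D [z45 z234 z235]]] := diagonal_normalize L3E b1D.
exists (sform (smul (b2 (X 2)) (b2 (Y 4))) (b2 (Y 5))); split.
  by case: b2D => sb fb _ _; apply: flagged_triple_neq0.
exact: diagonal_presented.
Qed.
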